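(* Let $\mathcal{H}$ be a permissible hypothesis space of functions $h:X\to A=[-\frac M2,\frac M2]^{T-1}$, let $l$ be the loss $l(\mathrm{t}_i,a)=-\log\frac{e^{a_i}}{1+\sum_{j=1}^{T-1}e^{a_j}}$ (with $a_T:=0$), and let the data be generated by $m$ independent draws from $X\times Y$ according to an (unknown) probability distribution $p$. Assume that an empirical risk minimizing (ERM) algorithm exists. Then the least $m$ required to ensure $(\alpha,\delta)$-PAC learnability of $\mathcal{H}$ is $$\frac{576M^2}{\alpha^2}\Big(\log\frac1\delta+\log\big(8\,\mathcal{C}(\tfrac{\alpha}{96T},\mathcal{H},\bar d_{l_1})\big)\Big).$$
   Context: Setting. $T$ is the number of targets, $K$ (an integer, $K\ll T$) the number of defender resources, $X=\{x\in[0,1]^T:\sum_{i=1}^T x_i\le K\}$ (defender mixed strategies), $Y=\{\mathrm{t}_1,\dots,\mathrm{t}_T\}$ where $\mathrm{t}_i\in\{0,1\}^T$ is the $i$-th unit vector (attack on target $i$), $Z=X\times Y$. $M\gg 1$ is a fixed constant. Hypotheses are functions $h=\langle h_1,\dots,h_{T-1}\rangle:X\to A=[-\frac M2,\frac M2]^{T-1}$. Risks. For a distribution $p$ on $Z$, the true risk is $r_h(p)=E_{(x,y)\sim p}[l(y,h(x))]$; for a sample $\vec z=((x_1,y_1),\dots,(x_m,y_m))\in Z^m$ the empirical risk is $\hat r_h(\vec z)=\frac1m\sum_{i=1}^m l(y_i,h(x_i))$. PAC learnability. $\mathcal{H}$ is called $(\alpha,\delta)$-PAC learnable if there is an ERM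 algorithm $\mathcal{A}$, mapping samples $\vec z$ to hypotheses $\mathcal{A}(\vec z)\in\mathcal{H}$, such that, for $\vec z$ consisting of $m$ i.i.d. draws from $p$, both (i) $Pr\big(\forall h\in\mathcal{H}:|\hat r_h(\vec z)-r_h(p)|<\alpha/3\big)>1-\delta/2$ and (ii) $Pr\big(|\hat r_{\mathcal{A}(\vec z)}(\vec z)-\inf_{h\in\mathcal{H}}\hat r_h(\vec z)|<\alpha/3\big)>1-\delta/2$ hold. (These two conditions imply $Pr(|r_{\mathcal{A}(\vec z)}(p)-\inf_{h\in\mathcal{H}}r_h(p)|<\alpha)>1-\delta$.) Capacity. For a pseudo-metric $d$ on $A$ and a probability measure $P$ on $X$, $d_{L^1(P,d)}(f,g)=\int_X d(f(x),g(x))\,dP(x)$. $\mathcal{N}(\epsilon,\mathcal{H},d')$ is the smallest size of a finite set $\mathcal{F}\subseteq\mathcal{H}$ such that every $h\in\mathcal{H}$ has some $f\in\mathcal{F}$ with $d'(f,h)\le\epsilon$. The capacity is $\mathcal{C}(\epsilon,\mathcal{H},d)=\sup_P\mathcal{N}(\epsilon,\mathcal{H},d_{L^1(P,d)})$, the supremum over all probability measures $P$ on $X$. $\bar d_{l_1}$ is the average $l_1$ distance on $\mathbb{R}^n$: $\bar d_{l_1}(a,b)=\frac1n\sum_{i=1}^n|a_i-b_i|$ (here $n=T-1$). Permissibility is the measurability condition on function classes defined in Pollard (1984).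
   Formalization: ''The least m required is'' is read as an upper bound: every m at least the stated quantity ensures PAC learnability; literal equality fails, e.g. for a single constant hypothesis h = 0, whose loss is constant, so m = 1 already suffices. *)

(* Defs.v *)
From HB Require Import structures.
From mathcomp Require Import all_boot all_order all_algebra.
From mathcomp Require Import all_classical all_reals all_analysis.

Set Implicit Arguments.
Unset Strict Implicit.
Unset Printing Implicit Defensive.

Import Order.TTheory GRing.Theory Num.Theory.
Import numFieldNormedType.Exports.

Local Open Scope classical_set_scope.
Local Open Scope ring_scope.

(* Throughout, n stands for T - 1, so that the T targets are indexed by
   'I_n.+1 and the last one, ord_max, is the reference target with a_T = 0. *)

Section spaces.
Context (R : realType) (n K : nat).

Definition strategy_pred (x : n.+1.-tuple R) : bool :=
  [forall i, 0 <= tnth x i <= 1] && (\sum_(i < n.+1) tnth x i <= K%:R).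

(* The set X of defender mixed strategies. *)
Definition strategy : Type := {x : n.+1.-tuple R | strategy_pred x}.

Lemma strategy_pred0 : strategy_pred [tuple 0 | i < n.+1].
Proof.
apply/andP; split; first by apply/forallP => i; rewrite tnth_mktuple lexx ler01.
by rewrite big1 ?ler0n// => i _; rewrite tnth_mktuple.
Qed.

HB.instance Definition _ := Choice.on strategy.
HB.instance Definition _ := isPointed.Build strategy
  (exist (fun x => is_true (strategy_pred x)) _ strategy_pred0).

(* X carries the Borel sigma-algebra inherited from R^T. *)
HB.instance Definition _ := Measurable.copy strategy
  (g_sigma_algebra_preimageType (fun x : strategy => val x : n.+1.-tuple R)).

(* The set Y of attacks: the index i represents the unit vector t_i; as a
   finite set Y carries the discrete sigma-algebra. *)
Definition attack : Type := 'I_n.+1.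

HB.instance Definition _ := Choice.on attack.
HB.instance Definition _ := isPointed.Build attack ord0.
HB.instance Definition _ := @isMeasurable.Build default_measure_display
  attack discrete_measurable discrete_measurable0
  discrete_measurableC discrete_measurableU.

Definition datum : Type := (strategy * attack)%type.

Definition hypothesis : Type := strategy -> n.-tuple R.

(* h takes its values in A = [-M/2, M/2]^(T-1). *)
Definition bounded_hypothesis (M : R) (h : hypothesis) : Prop :=
  forall x j, - (M / 2) <= tnth (h x) j <= M / 2.

(* l(t_i, a); the default value 0 of nth implements the convention a_T = 0. *)
Definition loss (y : attack) (a : n.-tuple R) : R :=
  - ln (expR (nth 0 a y) / (1 + \sum_(j < n) expR (tnth a j))).

Definition avg_l1 (a b : n.-tuple R) : R :=
  n%:R^-1 * \sum_(j < n) `|tnth a j - tnth b j|.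

End spaces.

Section iid.
Context d (S : measurableType d) (R : realType).

Definition tuple_cons m (s : S * m.-tuple S) : m.+1.-tuple S :=
  [tuple of s.1 :: s.2].

Lemma measurable_tuple_cons m : measurable_fun setT (@tuple_cons m).
Proof. exact: measurable_cons. Qed.

HB.instance Definition _ m := @isMeasurableFun.Build _ _ _ _
  (@tuple_cons m) (@measurable_tuple_cons m).

(* The m-fold product measure, i.e. the law of m independent draws from p. *)
Fixpoint iid_law (p : probability S R) (m : nat) : probability (m.-tuple S) R :=
  if m is m'.+1 then
    distribution (p \x iid_law p m')%E (@tuple_cons m')
  else \d_([tuple]).

(* Inner probability. On events that are measurable for the completion of P
   (in general, the only measurability available for events quantified over a
   permissible class) it is the probability under the completion of P. *)
Definition Pr (P : probability S R) (E : set S) : \bar R :=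
  ereal_sup [set P B | B in [set B | measurable B /\ B `<=` E]].

End iid.

(* Analytic sets; {ptws nat -> nat} is the Baire space. *)
Definition analytic (T : topologicalType) (A : set T) : Prop :=
  A = set0 \/
  exists g : {ptws nat -> nat} -> T, continuous g /\ A = range g.

(* Permissibility in the sense of Pollard: H is indexed, jointly measurably, by
   an analytic subset I of a compact metric space Theta. The sigma-algebra on
   S * I is the trace of the product of the one on S and the Borel sigma-algebra
   of Theta; the trace is spelled out because measurable_fun on a nonmeasurable
   domain such as setT `*` I would be vacuous. *)
Definition permissible (R : realType) d d' (S : measurableType d)
    (A : measurableType d') (H : set (S -> A)) : Prop :=
  exists (Theta : metricType R) (I : set Theta) (f : Theta -> S -> A),
    [/\ compact [set: Theta], analytic I, H = f @` I &
      forall B : set A, measurable B ->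
        exists2 C : set (S * Theta),
          <<s [set U `*` V | U in (measurable : set (set S)) & V in open] >> C &
          forall x theta, I theta -> (B (f theta x) <-> C (x, theta))].

Section capacity.
Context d (S : measurableType d) (R : realType) (A : Type).
Implicit Types (dist : A -> A -> R) (H : set (S -> A)).

Definition dL1 (P : probability S R) dist (f g : S -> A) : \bar R :=
  (\int[P]_x (dist (f x) (g x))%:E)%E.

(* +oo when there is no finite cover. *)
Definition covering_number (eps : R) H (dist : (S -> A) -> (S -> A) -> \bar R) :
    \bar R :=
  ereal_inf [set N%:R%:E | N in [set N | exists F : set (S -> A),
    [/\ F `<=` H, (F #= `I_N)%card &
        forall h, H h -> exists2 f, F f & (dist f h <= eps%:E)%E]]].

Definition capacity (eps : R) H dist : \bar R :=
  ereal_sup [set covering_number eps H (dL1 P dist) |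
             P in [set: probability S R]].

End capacity.

Section learning.
Context (R : realType) (n K : nat).
Local Notation hyp := (hypothesis R n K).
Local Notation Z := (datum R n K).

Definition true_risk (p : probability Z R) (h : hyp) : R :=
  \int[p]_z loss z.2 (h z.1).

Definition empirical_risk m (z : m.-tuple Z) (h : hyp) : R :=
  m%:R^-1 * \sum_(i < m) loss (tnth z i).2 (h (tnth z i).1).

Definition min_empirical_risk (H : set hyp) m (z : m.-tuple Z) : R :=
  inf [set empirical_risk z h | h in H].

Definition erm_algorithm (H : set hyp)
    (alg : forall m, m.-tuple Z -> hyp) : Prop :=
  forall m (z : m.-tuple Z), H (alg m z) /\
    forall h, H h -> empirical_risk z (alg m z) <= empirical_risk z h.

(* (alpha, delta)-PAC learnability of H from samples of size m; the data
   distribution p is unknown, so the algorithm may not depend on it. *)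
Definition pac_learnable (H : set hyp) (alpha delta : R) (m : nat) : Prop :=
  exists2 alg : forall m, m.-tuple Z -> hyp, erm_algorithm H alg &
    forall p : probability Z R,
      ((1 - delta / 2)%:E < Pr (iid_law p m)
        [set z | forall h, H h ->
           (`|empirical_risk z h - true_risk p h| < alpha / 3)%R])%E /\
      ((1 - delta / 2)%:E < Pr (iid_law p m)
        [set z | (`|empirical_risk z (alg m z) - min_empirical_risk H z|
                   < alpha / 3)%R])%E.

End learning.

(* Main.v *)
Require Import Defs.
From HB Require Import structures.
From mathcomp Require Import all_boot all_order all_algebra.
From mathcomp Require Import all_classical all_reals all_analysis.
From mathcomp Require Import measurable_realfun ring lra.

Set Implicit Arguments.
Unset Strict Implicit.
Unset Printing Implicit Defensive.

Import Order.TTheory GRing.Theory Num.Theory.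
Import numFieldNormedType.Exports.

Local Open Scope classical_set_scope.
Local Open Scope ring_scope.

(* Symmetrization with a ghost sample, a union bound over an L^1-cover taken for
   the empirical measure of the 2m sample points, and Hoeffding's inequality for
   Rademacher sums. The constants close because, for hypotheses bounded by M/2,
   the loss ranges over an interval of length 2M whatever T is, and it is
   1-Lipschitz for the (unnormalized) l1 distance.

   The uncountable quantifier over H is where permissibility enters: the event
   that some h has a large gap between the two samples is the projection of a
   measurable set along the Baire space, hence a Souslin set, hence capacitable:
   measurable subsets exhaust its outer probability. The average over exchanges
   of the two samples is applied to such a subset, and the ghost-sample step to a
   measurable hull. *)

(** * Souslin sets and their capacitability *)

(** Two steps pull measurability in opposite directions. The bound on the proportion of exchanges
    holds at every pair of samples, so it passes to measurable subsets of the large-gap event;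
    discarding bad samples requires a measurable superset, since each of them has to be caught.
    Capacitability gives the two nearly the same probability, at the price of an arbitrarily small
    [eta]. The cover may change with the sample points: the union bound is taken with these fixed
    and uses only the cardinality, which the supremum over all laws in the capacity controls
    uniformly. Constants: with eps = alpha/3, the ghost sample costs eps/2 and the cover eps/16, so
    Hoeffding is applied at 7 eps/16 to terms bounded by 2M. The exponent is (49/32) q with q =
    alpha^2 m / (576 M^2), and the prefactor is 8C: 2 from the threshold 1/2 on ghost samples, 2
    from the two tails, and 2C as a number strictly above the capacity C. The assumption on m gives
    8C exp(-q) <= delta; the excess of 49/32 over 1 supplies the missing factor 1/2 and the room for
    [eta]. *)

Definition agree (N : nat) (u v : nat -> nat) : Prop :=
  forall i, (i < N)%N -> u i = v i.

Lemma agreeW N N' u v : (N' <= N)%N -> agree N u v -> agree N' u v.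
Proof. by move=> le uv i iN; apply: uv; exact: leq_trans le. Qed.

Lemma agree_mkseq u k : agree k u (nth 0%N (mkseq u k)).
Proof. by move=> i ik; rewrite nth_mkseq. Qed.

(** Dependent choice along one branch: each prefix is extended by a chosen value; prefixes outside
    [P], which never arise, get the value 0. *)
Lemma prefix_choice (P : seq nat -> Prop) :
  P [::] -> (forall s, P s -> exists x, P (rcons s x)) ->
  exists w : nat -> nat, forall k, P (mkseq w k).
Proof.
move=> P0 PS.
have /choice[f fP] : forall s, exists x, P s -> P (rcons s x).
  move=> s; have [/PS[x Px]|nPs] := pselect (P s); first by exists x.
  by exists 0%N.
pose t := fix t k := if k is k'.+1 then rcons (t k') (f (t k')) else [::].
exists (fun k => f (t k)) => k.
suff -> : mkseq (fun k => f (t k)) k = t k by elim: k => //= k; exact: fP.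
by elim: k => // k IH; rewrite mkseqS IH.
Qed.

(** * Outer probability: measurable hulls and continuity from below *)

Section outer.
Context d (T : measurableType d) (R : realType) (P : probability T R).
Implicit Types A B : set T.
Local Open Scope ereal_scope.

Definition outer_prob A : \bar R :=
  ereal_inf [set P B | B in [set B | measurable B /\ A `<=` B]].

Lemma outer_prob_le A B : measurable B -> A `<=` B -> outer_prob A <= P B.
Proof. by move=> mB AB; apply: ereal_inf_lbound; exists B. Qed.

Lemma outer_prob_fin A : outer_prob A \is a fin_num.
Proof.
rewrite ge0_fin_numE; last by apply: le_ereal_inf_tmp => _ [B _ <-].
apply: le_lt_trans (outer_prob_le (measurableT) (@subsetT _ A)) _.
by rewrite probability_setT ltry.
Qed.

Lemma outer_prob_approx A (e : R) : (0 < e)%R ->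
  exists B, [/\ measurable B, A `<=` B & P B < outer_prob A + e%:E].
Proof.
move=> e0; have := lb_ereal_inf_adherent e0 (outer_prob_fin A).
by move=> [_ [B [mB AB] <-] PB]; exists B.
Qed.

Lemma outer_prob_hull A :
  exists B, [/\ measurable B, A `<=` B & P B = outer_prob A].
Proof.
have /choice[B HB] : forall n : nat, exists B, [/\ measurable B, A `<=` B &
    P B < outer_prob A + n.+1%:R^-1%:E].
  by move=> n; apply: outer_prob_approx.
have mB : measurable (\bigcap_n B n).
  by apply: bigcap_measurable => // n _; case: (HB n).
have AB : A `<=` \bigcap_n B n.
  by move=> x Ax n _; have [_ AB _] := HB n; exact: AB.
exists (\bigcap_n B n); split=> //; apply/eqP; rewrite eq_le outer_prob_le// andbT.
apply/lee_addgt0Pr => e e0.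
have [n ne] : exists n : nat, (n.+1%:R^-1 < e)%R.
  by exists (Num.truncn e^-1); rewrite invf_plt ?posrE//; apply: truncnS_gt.
apply: (@le_trans _ _ (P (B n))).
  by apply: le_measure; rewrite ?inE//; [case: (HB n)|exact: bigcap_inf].
case: (HB n) => _ _ /ltW /le_trans; apply.
by rewrite leeD2l// lee_fin ltW.
Qed.

(** Continuity from below without measurability. Hulls of the [F n] need not increase, but their
    tail intersections [G n] do, still contain [F n], and are no larger than the hull. *)
Lemma outer_prob_bigcup_gt (F : nat -> set T) (c : \bar R) :
  {homo F : n m / (n <= m)%N >-> n `<=` m} ->
  c < outer_prob (\bigcup_n F n) -> exists n, c < outer_prob (F n).
Proof.
move=> ndF cF; apply: contrapT => /forallNP nF.
have /choice[B HB] := fun n => outer_prob_hull (F n).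
pose G n := \bigcap_(k in [set k | (n <= k)%N]) B k.
have mG n : measurable (G n).
  by apply: bigcap_measurable; [exists n => /=|move=> k _; case: (HB k)].
have FG n : F n `<=` G n.
  by move=> x Fx k /= nk; have [_ FB _] := HB k; exact/FB/(ndF _ _ nk).
have PG n : P (G n) <= c.
  apply: (@le_trans _ _ (P (B n))).
    apply: le_measure; rewrite ?inE//; first by case: (HB n).
    by move=> x; apply => /=.
  by case: (HB n) => _ _ ->; rewrite leNgt; apply/negP; exact: nF.
have mUG : measurable (\bigcup_n G n) by exact: bigcup_measurable.
have ndG : {homo G : n m / (n <= m)%N >-> (n <= m)%O}.
  move=> n m nm; apply/subsetPset => x Gx k /= mk; apply: Gx => /=.
  exact: leq_trans mk.
have PUG := @nondecreasing_cvg_mu _ _ _ P _ mG mUG ndG.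
have : c < P (\bigcup_n G n).
  apply: lt_le_trans cF _; apply: outer_prob_le => // x [n _ Fx].
  by exists n => //; exact: FG.
apply/negP; rewrite -leNgt.
rewrite -(cvg_lim _ PUG)//; apply: lime_le; first by apply/cvg_ex; eexists; exact: PUG.
by apply: nearW => n; exact: PG.
Qed.

End outer.

Section souslin.
Context d (T : measurableType d) (R : realType).

(* The Souslin operation: the sieve Q k w depends on the first k values of w. *)
Definition souslin (A : set T) : Prop :=
  exists Q : nat -> (nat -> nat) -> set T,
    [/\ forall k w, measurable (Q k w),
        forall k u v, agree k u v -> Q k u = Q k v &
        forall x, A x <-> exists w, forall k, Q k w x].

(** Koenig's lemma: [X s] says that [s] starts admissible finite branches of every length. Below [b]
    only finitely many next values are possible, so some extension of [s] inherits the property. *)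
Lemma koenig (Q : nat -> (nat -> nat) -> Prop)
    (b : nat -> nat) :
  (forall k u v, agree k u v -> Q k u -> Q k v) ->
  (forall k, exists w, (forall i, (i < k)%N -> (w i <= b i)%N) /\
                       forall j, (j <= k)%N -> Q j w) ->
  exists w, forall k, Q k w.
Proof.
move=> Qagree Qfin.
pose V s k w := [/\ agree (size s) (nth 0%N s) w,
  forall i, (i < k)%N -> (w i <= b i)%N & forall j, (j <= k)%N -> Q j w].
pose X s := forall k, (size s <= k)%N -> exists w, V s k w.
have VW s k k' w : (k' <= k)%N -> V s k w -> V s k' w.
  move=> kk' [V1 V2 V3]; split => // i ik; first by apply: V2; exact: leq_trans kk'.
  by apply: V3; exact: leq_trans kk'.
have [||w wX] := @prefix_choice X.
- by move=> k _; have [w [w1 w2]] := Qfin k; exists w.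
- move=> s Xs; apply: contrapT => /forallNP nX.
  have /choice[kf kfP] : forall x, exists k,
      (size s < k)%N /\ forall w, ~ V (rcons s x) k w.
    move=> x; have /existsNP[k /not_implyP[sk nV]] := nX x.
    by exists k; rewrite size_rcons in sk; split => // w Vw; apply: nV; exists w.
  (* By this depth every value up to [b (size s)] has failed, yet a branch reaching it must use one
     of them. *)
  pose m := \max_(x < (b (size s)).+1) kf x.
  have sm : (size s < m)%N.
    by apply: leq_trans (kfP 0%N).1 _; exact: (@leq_bigmax _ (fun x : 'I_ _ => kf x) ord0).
  have [w Vw] := Xs m (ltnW sm).
  have [V1 V2 V3] := Vw.
  have wb : (w (size s) < (b (size s)).+1)%N by rewrite ltnS; exact: V2.
  have [_ /(_ w)] := kfP (w (size s)); apply.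
  apply: (@VW _ m); first exact: (@leq_bigmax _ (fun x : 'I_ _ => kf x) (Ordinal wb)).
  split => // i; rewrite size_rcons ltnS nth_rcons leq_eqVlt => /predU1P[->|si].
    by rewrite ltnn eqxx.
  by rewrite si; exact: V1.
exists w => k; have [] := wX k k; first by rewrite size_mkseq.
move=> v [v1 _ v3]; apply: (Qagree k v); last exact: v3.
move=> i ik; rewrite -v1 ?size_mkseq//; by rewrite nth_mkseq.
Qed.

(* Souslin sets are capacitable: the bounds b are chosen one coordinate at a
   time so that the part of A with branches below b keeps its outer
   probability, and compactness of the branches below b does the rest. *)
Lemma souslin_capacitable (P : probability T R) (A : set T) (e : R) :
  souslin A -> 0 < e -> exists B, [/\ measurable B, B `<=` A &
    (outer_prob P A <= P B + e%:E)%E].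
Proof.
move=> [Q [mQ Qagree AE]] e0.
pose below (s : seq nat) (w : nat -> nat) :=
  forall i, (i < size s)%N -> (w i <= nth 0%N s i)%N.
pose As s := [set x | exists2 w, below s w & forall k, Q k w x].
pose c := (outer_prob P A - e%:E)%E.
have [||b bP] := @prefix_choice (fun s => (c < outer_prob P (As s))%E).
- suff -> : As [::] = A.
    by rewrite /c lteBlDr// lteDl ?outer_prob_fin// lte_fin.
  apply/seteqP; split=> x; first by move=> [w _ ?]; apply/AE; exists w.
  by move=> /AE[w ?]; exists w.
- move=> s cs.
  have AsE : As s = \bigcup_n As (rcons s n).
    apply/seteqP; split => [x [w ws wQ]|x [n _ [w ws wQ]]].
      exists (w (size s)) => //; exists w => // i.
      rewrite size_rcons ltnS nth_rcons leq_eqVlt => /predU1P[->|si].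
        by rewrite ltnn eqxx.
      by rewrite si; exact: ws.
    exists w => // i si; have := ws i; rewrite size_rcons nth_rcons si; apply.
    exact: ltnW.
  apply: outer_prob_bigcup_gt; last by rewrite -AsE.
  move=> n m nm x [w ws wQ]; exists w => // i; rewrite size_rcons => si.
  have := ws i; rewrite size_rcons => /(_ si) /leq_trans; apply.
  by rewrite !nth_rcons; case: ifP => // _; case: ifP.
(* Only finite prefixes enter [Bs k], so the uncountable union over branches becomes a countable one
   over sequences, hence measurable. It contains [As (mkseq b k)], so its probability is at least
   [c]. *)
pose Bs k := \bigcup_(s in [set s : seq nat | size s = k /\
    forall i, (i < k)%N -> (nth 0 s i <= b i)%N])
  \bigcap_(j in [set j | (j <= k)%N]) Q j (nth 0%N s).
have BsP k x : Bs k x <-> exists w, (forall i, (i < k)%N -> (w i <= b i)%N) /\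
                       forall j, (j <= k)%N -> Q j w x.
  split=> [[s [sk sb] Qs]|[w [wb Qw]]]; first by exists (nth 0%N s).
  exists (mkseq w k) => [/=|j /= jk].
    by rewrite size_mkseq; split => // i ik; rewrite nth_mkseq//; exact: wb.
  rewrite -(Qagree j w); first exact: Qw.
  exact: (agreeW jk (@agree_mkseq w k)).
have mBs k : measurable (Bs k).
  rewrite /Bs bigcup_mkcond; apply: countable_bigcupT_measurable => // s.
  by case: ifP => // _; apply: bigcap_measurable; [exists 0%N|].
have PBs k : (c <= P (Bs k))%E.
  apply: le_trans (ltW (bP k)) _; apply: outer_prob_le => // x [w wb Qw].
  apply/BsP; exists w; split => // i ik.
  by have := wb i; rewrite size_mkseq nth_mkseq//; exact.
have mI : measurable (\bigcap_k Bs k) by exact: bigcap_measurable.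
have niB : {homo Bs : n m / (n <= m)%N >-> (m <= n)%O}.
  move=> n m nm; apply/subsetPset => x /BsP[w [wb Qw]]; apply/BsP; exists w.
  by split=> i ik; [apply: wb|apply: Qw]; exact: leq_trans nm.
exists (\bigcap_k Bs k); split => //.
  move=> x Bx; apply/AE.
  apply: (@koenig (fun k w => Q k w x) b).
    by move=> k u v /Qagree ->.
  by move=> k; apply/BsP; exact: Bx.
rewrite -leeBlDr//.
have B0 : (P (Bs 0%N) < +oo)%E.
  by apply: le_lt_trans (probability_le1 _ _) _ => //; rewrite ltry.
have cvP := @nonincreasing_cvg_mu _ _ _ P _ B0 mBs mI niB.
rewrite -(cvg_lim _ cvP)//; apply: lime_ge; first by apply/cvg_ex; eexists; exact: cvP.
by apply: nearW => n; exact: PBs.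
Qed.

End souslin.

(** * Measurable projections along the Baire space *)

Section projection.
Context d (T : measurableType d).
Implicit Types C D : set (T * (nat -> nat)).

Definition locally_constant (U : Type) (F : (nat -> nat) -> (nat -> nat) -> U) :=
  forall u v, exists N, forall u' v', agree N u u' -> agree N v v' ->
    F u' v' = F u v.

(* Projections along v of countable intersections of open-closed sets with
   measurable sections. *)
Definition souslin_scheme C : Prop :=
  exists Q : nat -> (nat -> nat) -> (nat -> nat) -> set T,
    [/\ forall k u v, measurable (Q k u v),
        forall k, locally_constant (Q k) &
        forall x u, C (x, u) <-> exists v, forall k, Q k u v x].

Definition code_shift (v : nat -> nat) : nat -> nat := fun i => v i.+1.
Definition code_row (i : nat) (v : nat -> nat) : nat -> nat :=
  fun j => v (pickle (i, j)).

(** The first value of [v] names the set of the union, and the rest is the witness for it. *)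
Lemma souslin_scheme_bigcup (C : nat -> set (T * (nat -> nat))) :
  (forall i, souslin_scheme (C i)) -> souslin_scheme (\bigcup_i C i).
Proof.
move=> /choice[Q HQ].
exists (fun k u v => Q (v 0%N) k u (code_shift v)); split.
- by move=> k u v; have [+ _ _] := HQ (v 0%N); apply.
- move=> k u v; have [_ lQ _] := HQ (v 0%N).
  have [N NP] := lQ k u (code_shift v); exists N.+1 => u' v' uu vv.
  rewrite -(vv 0%N)//; apply: NP; first exact: agreeW uu.
  by move=> i iN; rewrite /code_shift vv.
- move=> x u; split => [[i _ Cx]|[v vQ]].
    have [_ _ QE] := HQ i; have [v vQ] := (QE x u).1 Cx.
    by exists (fun j => if j is j'.+1 then v j' else i).
  exists (v 0%N) => //; have [_ _ QE] := HQ (v 0%N); apply/QE.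
  by exists (code_shift v).
Qed.

(** One [v] carries the witnesses for all [C i] at once, as the rows of a matrix coded by
    [pickle]. *)
Lemma souslin_scheme_bigcap (C : nat -> set (T * (nat -> nat))) :
  (forall i, souslin_scheme (C i)) -> souslin_scheme (\bigcap_i C i).
Proof.
move=> /choice[Q HQ].
exists (fun k u v => if unpickle k is Some (i, j) then Q i j u (code_row i v)
                     else setT); split.
- move=> k u v; case: unpickle => [[i j]|]//.
  by have [+ _ _] := HQ i; apply.
- move=> k u v; case: unpickle => [[i j]|]; last by exists 0%N.
  have [_ lQ _] := HQ i; have [N NP] := lQ j u (code_row i v).
  exists (maxn N (\max_(l < N) (pickle (i, l : nat)).+1)) => u' v' uu vv.
  apply: NP; first by apply: agreeW uu; exact: leq_maxl.
  move=> l lN; apply: vv; rewrite leq_max; apply/orP; right.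
  exact: (@leq_bigmax _ (fun l : 'I_N => (pickle (i, l : nat)).+1) (Ordinal lN)).
- move=> x u; split => [Cx|[v vQ] i _].
    have /choice[v vQ] : forall i, exists v, forall k, Q i k u v x.
      by move=> i; have [_ _ QE] := HQ i; apply/QE; exact: Cx.
    exists (fun k => if unpickle k is Some (i, j) then v i j else 0%N) => k.
    case: unpickle => [[i j]|]//; rewrite (_ : code_row _ _ = v i)//.
    by apply/funext => l; rewrite /code_row pickleK.
  have [_ _ QE] := HQ i; apply/QE; exists (code_row i v) => j.
  by have := vQ (pickle (i, j)); rewrite pickleK.
Qed.

Definition evens (w : nat -> nat) : nat -> nat := fun i => w i.*2.
Definition odds (w : nat -> nat) : nat -> nat := fun i => w i.*2.+1.

(** The branch [w] interleaves [u] and the witness [v]. A sieve at level k may look only at k values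
    of [w], so it imposes [Q j] only once these values determine it; local constancy ensures that
    every [Q j] is imposed eventually. *)
Lemma souslin_projection C :
  souslin_scheme C -> souslin [set x | exists u, C (x, u)].
Proof.
move=> [Q [mQ lQ QE]].
pose const k w j := forall w', agree k w w' ->
  Q j (evens w') (odds w') = Q j (evens w) (odds w).
exists (fun k w => \bigcap_(j in [set j | (j <= k)%N /\ const k w j])
  Q j (evens w) (odds w)); split.
- by move=> k w; rewrite bigcap_mkcond; apply: bigcapT_measurable => j; case: ifP.
- have half k u v : agree k u v -> forall x,
    (forall j, (j <= k)%N /\ const k u j -> Q j (evens u) (odds u) x) ->
    forall j, (j <= k)%N /\ const k v j -> Q j (evens v) (odds v) x.
    move=> uv x Qu j [jk cj].
    rewrite -(cj u); last by move=> i ik; rewrite uv.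
    apply: Qu; split => // w uw; rewrite cj; last by move=> i ik; rewrite -uv// uw.
    by rewrite -(cj u)// => i ik; rewrite uv.
  move=> k u v uv; apply/seteqP; split => x Qx.
    exact: half uv _ Qx.
  by apply: (half k v) => // i ik; rewrite uv.
- move=> x; split => [[u /QE[v uv]]|[w Qw]].
    exists (fun i => if odd i then v i./2 else u i./2) => k j _.
    rewrite (_ : evens _ = u); last first.
      by apply/funext => i; rewrite /evens odd_double doubleK.
    rewrite (_ : odds _ = v)//.
    by apply/funext => i; rewrite /odds /= odd_double/= uphalf_double.
  exists (evens w); apply/QE; exists (odds w) => j.
  have [N NP] := lQ j (evens w) (odds w).
  apply: (Qw (maxn j N.*2)); split; first exact: leq_maxl.
  move=> w' ww'; apply: NP => i iN; apply: ww'.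
    by rewrite leq_max ltn_double iN orbT.
  by rewrite leq_max ltn_Sdouble iN orbT.
Qed.

Section pullback.
Context (E : topologicalType) (g : {ptws nat -> nat} -> E).
Hypothesis g_continuous : continuous g.

(** If no cylinder worked, the counterexamples [s N] would converge pointwise to [u] while their
    images avoid [V]. *)
Lemma open_cylinder (V : set E) u : open V -> V (g u) ->
  exists N, forall u', agree N u u' -> V (g u').
Proof.
move=> oV Vu; apply: contrapT => /forallNP nV.
have /choice[s sP] : forall N, exists u', agree N u u' /\ ~ V (g u').
  by move=> N; have /existsNP[u' /not_implyP] := nV N; exists u'.
have su : {ptws, s @ \oo --> (u : nat -> nat)}.
  apply/pointwise_cvgP => t.
  change ((fun N => s N t) @ \oo --> u t).
  apply: cvg_near_cst; near=> N.
  have [us _] := sP N; apply/esym/us; near: N; exact: nbhs_infty_gt.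
have nV' : nbhs (u : {ptws nat -> nat}) (g @^-1` V).
  by apply: g_continuous; exact: open_nbhs_nbhs.
have [N _ /(_ N)] := su _ nV'; rewrite /= leqnn => /(_ isT).
by have [_] := sP N.
Unshelve. all: by end_near. Qed.

Definition baire_rectangles : set (set (T * (nat -> nat))) :=
  [set U `*` (g @^-1` V) | U in measurable & V in open].

(** For the rectangle, [v 0] guesses the length of a cylinder around [u] on which [g] stays in [V].
    For the complement, [v 0 = 0] claims that the point is outside [U]; any other value claims that
    no cylinder around [u] works, that is, that [g u] is outside [V]. *)
Let rectangle_scheme U V : measurable U -> open V ->
  souslin_scheme (U `*` (g @^-1` V)) /\ souslin_scheme (~` (U `*` (g @^-1` V))).
Proof.
move=> mU oV.
pose inV k u := forall u', agree k u u' -> V (g u').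
have inVE k u u' : agree k u u' -> inV k u = inV k u'.
  move=> uu; apply/propext; split=> iV w uw; apply: iV => i ik.
    by rewrite uu// uw.
  by rewrite -uu// uw.
split.
- exists (fun _ u v => if `[< inV (v 0%N) u >] then U else set0); split.
  + by move=> k u v; case: ifP.
  + move=> _ u v; exists (v 0%N).+1 => u' v' uu vv.
    rewrite -(vv 0%N)// (@inVE _ u u')//.
    exact: (agreeW (leqnSn _) uu).
  + move=> x u; split => [[/= Ux Vu]|[v /(_ 0%N)]].
      have [N NP] := open_cylinder oV Vu.
      by exists (fun=> N) => _; case: asboolP.
    by case: asboolP => // iV Ux; split => //=; exact: iV.
- exists (fun k u v => if v 0%N == 0%N then ~` U else
     if `[< inV k u >] then set0 else setT); split.
  + by move=> k u v; case: ifP => _; [exact: measurableC|case: ifP].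
  + move=> k u v; exists k.+1 => u' v' uu vv.
    rewrite -(vv 0%N)// (@inVE _ u u')//.
    exact: (agreeW (leqnSn _) uu).
  + move=> x u; split => [nUV|[v vQ] [/= Ux Vu]].
      have [Ux|nUx] := pselect (U x); last by exists (fun=> 0%N).
      exists (fun=> 1%N) => k /=; case: asboolP => // iV; apply: nUV.
      by split => //=; exact: iV.
    have := vQ 0%N; case: eqP => //= v0 _.
    have [N NP] := open_cylinder oV Vu.
    by have := vQ N; case: eqP => // _; case: asboolP.
Qed.

(** Schemes are closed under countable unions and intersections; asking for a scheme of the
    complement as well yields a sigma-algebra. *)
Lemma generated_souslin_projection D : <<s baire_rectangles >> D ->
  souslin [set x | exists u, D (x, u)].
Proof.
move=> sD; apply: souslin_projection.
suff /(_ D sD) [] : <<s baire_rectangles >> `<=`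
  [set D | souslin_scheme D /\ souslin_scheme (~` D)] by [].
have [s0 sT] : souslin_scheme set0 /\ souslin_scheme setT.
  split; [exists (fun _ _ _ => set0)|exists (fun _ _ _ => setT)]; split=> //.
  - by move=> k u v; exists 0%N.
  - by move=> x u; split => // -[v /(_ 0%N)].
  - by move=> k u v; exists 0%N.
apply: smallest_sub; last first.
  by move=> _ [U mU [V oV <-]]; exact: rectangle_scheme.
split => [|A [sA sCA]|F sF] /=.
- by rewrite setC0.
- by rewrite setTD setCK.
- split; first by apply: souslin_scheme_bigcup => i; case: (sF i).
  rewrite setC_bigcup; apply: souslin_scheme_bigcap => i; by case: (sF i).
Qed.

End pullback.
End projection.

(** * Independent samples *)

Section iid_law_theory.
Context d (S : measurableType d) (R : realType) (p : probability S R).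
Local Open Scope ereal_scope.

Lemma iid_lawS_integral m (F : m.+1.-tuple S -> \bar R) :
  measurable_fun [set: m.+1.-tuple S] F -> (forall z, 0 <= F z) ->
  \int[iid_law p m.+1]_z F z =
  \int[p]_s \int[iid_law p m]_t F (tuple_cons (s, t)).
Proof.
move=> mF F0 /=; rewrite ge0_integral_pushforward//.
rewrite preimage_setT fubini_tonelli1//; first exact: measurableT_comp.
by move=> ? /=.
Qed.

Definition double_cons m (ss : S * S) (tt : m.-tuple S * m.-tuple S) :
  m.+1.-tuple S * m.+1.-tuple S :=
  (tuple_cons (ss.1, tt.1), tuple_cons (ss.2, tt.2)).

Lemma measurable_double_cons m ss :
  measurable_fun [set: m.-tuple S * m.-tuple S] (double_cons ss).
Proof.
apply: measurable_fun_pair; apply: measurable_cons => //=.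
- exact: measurable_fst.
- exact: measurable_snd.
Qed.

(** The iterated form follows the recursion of [iid_law], so that one observation at a time can be
    peeled off both samples. *)
Definition double_integral m (F : m.-tuple S * m.-tuple S -> \bar R) :=
  \int[iid_law p m]_z \int[iid_law p m]_z' F (z, z').

Lemma double_integralS m (F : m.+1.-tuple S * m.+1.-tuple S -> \bar R) :
  measurable_fun [set: m.+1.-tuple S * m.+1.-tuple S] F -> (forall z, 0 <= F z) ->
  double_integral F =
  \int[p]_s \int[p]_s' double_integral (F \o double_cons (s, s')).
Proof.
move=> mF F0; rewrite /double_integral iid_lawS_integral; last 2 first.
- exact: measurable_fun_fubini_tonelli_F.
- by move=> z; exact: integral_ge0.
apply: eq_integral => s _.
transitivity (\int[iid_law p m]_t \int[p]_s' \int[iid_law p m]_t'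
    F (double_cons (s, s') (t, t'))).
  apply: eq_integral => t _; rewrite iid_lawS_integral//.
  exact: measurable_fun_pair2.
have mG : measurable_fun [set: (m.-tuple S * S) * m.-tuple S]
    (fun x => F (tuple_cons (s, x.1.1), tuple_cons (x.1.2, x.2))).
  apply: measurableT_comp => //.
  apply: measurable_fun_pair; apply: measurable_cons => //=.
  - exact: measurableT_comp.
  - exact: measurableT_comp.
  - exact: measurable_snd.
apply: (@fubini_tonelli _ _ _ _ _ (iid_law p m) p (fun y => \int[iid_law p m]_t'
    F (double_cons (s, y.2) (y.1, t')))) => /=.
- exact: (@measurable_fun_fubini_tonelli_F _ _ _ _ _ (iid_law p m) _ mG).
- by move=> y; exact: integral_ge0.
Qed.

Definition exchange m (sg : 'I_m -> bool) (zz : m.-tuple S * m.-tuple S) :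
    m.-tuple S * m.-tuple S :=
  ([tuple if sg i then tnth zz.2 i else tnth zz.1 i | i < m],
   [tuple if sg i then tnth zz.1 i else tnth zz.2 i | i < m]).

Lemma measurable_exchange m (sg : 'I_m -> bool) :
  measurable_fun [set: m.-tuple S * m.-tuple S] (exchange sg).
Proof.
apply: measurable_fun_pair; apply/measurable_fun_tnthP => i.
- rewrite (_ : _ \o _ = fun zz => if sg i then tnth zz.2 i else tnth zz.1 i).
    by case: (sg i); apply: (measurableT_comp (measurable_tnth _)).
  by apply/funext => zz /=; rewrite tnth_mktuple.
- rewrite (_ : _ \o _ = fun zz => if sg i then tnth zz.1 i else tnth zz.2 i).
    by case: (sg i); apply: (measurableT_comp (measurable_tnth _)).
  by apply/funext => zz /=; rewrite tnth_mktuple.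
Qed.

Lemma exchange_double_cons m (sg : 'I_m.+1 -> bool) ss tt :
  exchange sg (double_cons ss tt) =
  double_cons (if sg ord0 then (ss.2, ss.1) else ss)
    (exchange (fun i => sg (lift ord0 i)) tt).
Proof.
congr pair; apply: eq_from_tnth => i; rewrite tnth_mktuple;
  case: (unliftP ord0 i) => [j ->|->].
- by rewrite !tnthS/= tnth_mktuple.
- by rewrite !tnth0/=; case: ifP.
- by rewrite !tnthS/= tnth_mktuple.
- by rewrite !tnth0/=; case: ifP.
Qed.

(** By induction on [m]: exchanging the first two observations is Tonelli's theorem for [p] with
    itself, and the other pairs are exchanged inside the integral. *)
Lemma double_integral_exchange m (sg : 'I_m -> bool)
    (F : m.-tuple S * m.-tuple S -> \bar R) :
  measurable_fun [set: m.-tuple S * m.-tuple S] F -> (forall z, 0 <= F z) ->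
  double_integral (F \o exchange sg) = double_integral F.
Proof.
elim: m sg F => [|m IH] sg F mF F0.
  congr double_integral; apply/funext => z /=.
  by congr F; case: z => z z'; rewrite /exchange [z]tuple0 [z']tuple0; congr pair;
    apply: eq_from_tnth => -[].
have mFs : measurable_fun [set: m.+1.-tuple S * m.+1.-tuple S] (F \o exchange sg).
  exact: (measurableT_comp mF (measurable_exchange sg)).
rewrite (double_integralS mF F0) (double_integralS mFs); last by move=> z; exact: F0.
pose ss (s s' : S) := if sg ord0 then (s', s) else (s, s').
transitivity (\int[p]_s \int[p]_s' double_integral (F \o double_cons (ss s s'))).
  apply: eq_integral => s _; apply: eq_integral => s' _.
  transitivity (double_integral
      ((F \o double_cons (ss s s')) \o exchange (fun i => sg (lift ord0 i)))).
    congr double_integral; apply/funext => tt.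
    rewrite [LHS]/= exchange_double_cons /ss /=.
    by case: ifP.
  apply: IH => [|z]; last exact: F0.
  exact: (measurableT_comp mF (measurable_double_cons (ss s s'))).
rewrite {}/ss; case: (sg ord0); last by [].
pose G (y : S * S) := double_integral (F \o double_cons y).
have mG : measurable_fun [set: S * S] G.
  have mH : measurable_fun [set: ((S * S) * m.-tuple S) * m.-tuple S]
      (fun x => F (tuple_cons (x.1.1.1, x.1.2), tuple_cons (x.1.1.2, x.2))).
    apply: measurableT_comp => //.
    apply: measurable_fun_pair; apply: measurable_cons => //=;
      try exact: measurable_snd; by do ?apply: measurableT_comp.
  apply: (@measurable_fun_fubini_tonelli_F _ _ _ _ _ (iid_law p m)
    (fun x : (S * S) * m.-tuple S => \int[iid_law p m]_t'
       F (tuple_cons (x.1.1, x.2), tuple_cons (x.1.2, t')))).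
    exact: (@measurable_fun_fubini_tonelli_F _ _ _ _ _ (iid_law p m) _ mH).
  by move=> y; exact: integral_ge0.
have G0 y : 0 <= G y.
  by apply: integral_ge0 => z _; apply: integral_ge0 => z' _; exact: F0.
exact: (esym (@fubini_tonelli _ _ _ _ _ p p G mG G0)).
Qed.

End iid_law_theory.

Lemma probability_fin_num d (T : measurableType d) (R : realType)
  (P : probability T R) (A : set T) : measurable A -> P A \is a fin_num.
Proof. exact: fin_num_measure. Qed.

Lemma integral_prob_cst d (T : measurableType d) (R : realType)
  (P : probability T R) (r : \bar R) : (\int[P]_x cst r x = r)%E.
Proof.
rewrite integral_cst// -[RHS]mule1; congr (_ * _)%E; exact: probability_setT.
Qed.

Section averaging.
Context d (S : measurableType d) (R : realType) (p : probability S R).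
Local Open Scope ereal_scope.
Local Notation Q := (iid_law p).

Lemma iid_law2_exchange m (sg : 'I_m -> bool) (B : set (m.-tuple S * m.-tuple S)) :
  measurable B -> (Q m \x Q m) (exchange sg @^-1` B) = (Q m \x Q m) B.
Proof.
move=> mB.
have E (D : set (m.-tuple S * m.-tuple S)) : measurable D ->
    (Q m \x Q m) D = double_integral p (fun zz => (\1_D zz)%:E).
  move=> mD; rewrite -[D in LHS]setIT -integral_indic// fubini_tonelli1//.
  by apply/measurable_EFinP; exact: measurable_indic.
have mW : measurable (exchange sg @^-1` B).
  by rewrite -[X in measurable X]setTI; exact: (@measurable_exchange _ _ _ sg measurableT _ mB).
rewrite (E _ mW) (E _ mB).
apply: (double_integral_exchange p sg (F := fun zz => (\1_B zz)%:E)); last by move=> zz; rewrite lee_fin.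
by apply/measurable_EFinP; exact: measurable_indic.
Qed.

(** The 2^m preimages of [B] under exchanges are equiprobable, so the probability of [B] is the
    integral of the average of their indicators, which is pointwise at most [c]. *)
Lemma iid_law2_average m (B : set (m.-tuple S * m.-tuple S)) (c : R) :
  measurable B ->
  (forall zz, (\sum_(sg : {ffun 'I_m -> bool}) \1_B (exchange sg zz) <= c * 2 ^+ m)%R) ->
  (Q m \x Q m) B <= c%:E.
Proof.
move=> mB Bc.
have mW (sg : {ffun 'I_m -> bool}) : measurable (exchange sg @^-1` B).
  by rewrite -[X in measurable X]setTI; exact: (@measurable_exchange _ _ _ sg measurableT _ mB).
have mI (sg : {ffun 'I_m -> bool}) :
    measurable_fun [set: m.-tuple S * m.-tuple S]
      (fun zz => (\1_(exchange sg @^-1` B) zz : R)%:E).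
  by apply/measurable_EFinP; exact: measurable_indic.
have H : \int[Q m \x Q m]_zz
    (\sum_(sg : {ffun 'I_m -> bool}) (\1_(exchange sg @^-1` B) zz)%:E) <=
    (c * 2 ^+ m)%:E.
  have -> : (c * 2 ^+ m)%:E = \int[Q m \x Q m]_zz (cst (c * 2 ^+ m)%:E zz).
    exact: (esym (integral_prob_cst (Q m \x Q m) _)).
  apply: ge0_le_integral => //.
  - by move=> zz _; apply: sume_ge0 => sg _; rewrite lee_fin.
  - exact: emeasurable_sum.
  - by move=> zz _; rewrite sumEFin lee_fin; exact: Bc.
move: H; rewrite ge0_integral_sum//.
have E (sg : {ffun 'I_m -> bool}) : \int[Q m \x Q m]_zz (\1_(exchange sg @^-1` B) zz)%:E =
    (Q m \x Q m) B.
  transitivity ((Q m \x Q m) (exchange sg @^-1` B `&` setT)).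
    exact: (integral_indic _ measurableT (mW sg)).
  by rewrite setIT; exact: iid_law2_exchange.
rewrite (eq_bigr _ (fun sg _ => E sg)).
have PB : (Q m \x Q m) B \is a fin_num.
  exact: (@probability_fin_num _ _ _ (Q m \x Q m) _ mB).
rewrite -(fineK PB) sumEFin !lee_fin sumr_const card_ffun card_bool card_ord.
by rewrite -[X in (X <= _)%R]mulr_natr natrX ler_pM2r// exprn_gt0.
Qed.

End averaging.

(** * The ghost sample: sections of large probability and Chebyshev's inequality *)

Section symmetrization.
Context d1 d2 (T1 : measurableType d1) (T2 : measurableType d2) (R : realType).
Context (P1 : probability T1 R) (P2 : probability T2 R).
Local Open Scope ereal_scope.

(** Markov's inequality for the probability of the section, whose integral is the product
    probability of [C]; the factor 2 is the inverse of the threshold. *)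
Lemma half_sections (C : set (T1 * T2)) : measurable C ->
  exists D : set T1, [/\ measurable D,
    (forall x, 2^-1%:E <= P2 (xsection C x) -> D x) &
    P1 D <= 2%:E * (P1 \x P2) C].
Proof.
move=> mC.
have mf := measurable_fun_xsection P2 mC.
exists (setT `&` [set x | 2^-1%:E <= `| (P2 \o xsection C) x |]); split.
- apply: emeasurable_fun_c_infty => //.
  exact: (measurableT_comp _ mf).
- by move=> x Cx; split => //=; rewrite gee0_abs.
have := @le_integral_abse _ _ _ P1 _ measurableT _ (2^-1)%R mf.
rewrite invr_gt0 ltr0n => /(_ isT).
set D := _ `&` _ => PD.
have {PD}: 2^-1%:E * P1 D <= (P1 \x P2) C.
  apply: le_trans PD _; rewrite le_eqVlt; apply/orP; left; apply/eqP.
  by rewrite /product_measure1; apply: eq_integral => x _; rewrite gee0_abs.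
move=> PD; have := lee_wpmul2l (_ : 0 <= 2%:E) PD.
by rewrite lee_fin ler0n => /(_ isT); rewrite muleA -EFinM divff ?mul1e.
Qed.

End symmetrization.

Section second_moment.
Context d (S : measurableType d) (R : realType) (p : probability S R).
Variables (f : S -> R) (B : R).
Hypotheses (mf : measurable_fun [set: S] f) (fB : forall s, `|f s| <= B).

Lemma bounded_integrable : p.-integrable setT (EFin \o f).
Proof.
apply: measurable_bounded_integrable => //; first exact: fin_num_fun_lty.
exists B; split; first exact: num_real.
by move=> x Bx y _; exact: le_trans (ltW Bx).
Qed.

Hypothesis f0 : (\int[p]_s (f s)%:E = 0)%E.

(** The cross term 2 c f integrates to zero by [f0]. In the induction that follows, [c] is the sum
    over the remaining observations, held fixed. *)
Lemma second_moment_shift (c : R) :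
  (\int[p]_s ((f s + c) ^+ 2)%:E <= (B ^+ 2 + c ^+ 2)%:E)%E.
Proof.
have B0 : 0 <= B by exact: le_trans (fB point).
have If := bounded_integrable.
have Ic := finite_measure_integrable_cst p (B ^+ 2 + c ^+ 2) (@measurableT _ S).
have IZ := integrableZl (@measurableT _ S) (2 * c) If.
have -> : ((B ^+ 2 + c ^+ 2)%:E = \int[p]_s
    ((EFin \o cst (B ^+ 2 + c ^+ 2)%R) s + (2 * c)%:E * (EFin \o f) s))%E.
  rewrite integralD// integralZl// f0 mule0 adde0.
  exact: (esym (integral_prob_cst p _)).
apply: ge0_le_integral => //.
- by move=> s _; rewrite lee_fin sqr_ge0.
- apply/measurable_EFinP; apply: measurable_funX.
  by apply: measurable_funD => //; exact: measurable_cst.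
- apply: (measurable_int p); exact: integrableD.
move=> s _; rewrite /= -EFinM -EFinD lee_fin.
have : f s ^+ 2 <= B ^+ 2 by rewrite -(real_normK (num_real (f s))) ler_sqr// nnegrE.
by nra.
Qed.

Lemma measurable_tuple_sum m :
  measurable_fun [set: m.-tuple S] (fun z => \sum_(i < m) f (tnth z i)).
Proof.
apply: measurable_sum => i.
exact: (measurableT_comp mf (measurable_tnth i)).
Qed.

Lemma iid_second_moment m :
  (\int[iid_law p m]_z ((\sum_(i < m) f (tnth z i)) ^+ 2)%:E <=
   (m%:R * B ^+ 2)%:E)%E.
Proof.
elim: m => [|m IH].
  rewrite (eq_integral (cst 0%E)).
    by rewrite integral_cst// mul0e mul0r.
  by move=> z _; rewrite big_ord0 expr0n.
have mS : measurable_fun [set: m.-tuple S]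
    (fun z => \sum_(i < m) f (tnth z i)) by exact: measurable_tuple_sum.
rewrite iid_lawS_integral; last 2 first.
- by apply/measurable_EFinP; apply: measurable_funX; exact: measurable_tuple_sum.
- by move=> z; rewrite lee_fin sqr_ge0.
pose G (x : S * m.-tuple S) :=
  ((f x.1 + \sum_(i < m) f (tnth x.2 i)) ^+ 2)%:E.
have mG : measurable_fun [set: S * m.-tuple S] G.
  apply/measurable_EFinP; apply: measurable_funX; apply: measurable_funD.
    exact: (measurableT_comp mf measurable_fst).
  exact: (measurableT_comp mS measurable_snd).
have G0 x : (0 <= G x)%E by rewrite lee_fin sqr_ge0.
have -> : (\int[p]_s \int[iid_law p m]_t
    ((\sum_(i < m.+1) f (tnth (tuple_cons (s, t)) i)) ^+ 2)%:E =
    \int[p]_s \int[iid_law p m]_t G (s, t))%E.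
  apply: eq_integral => s _; apply: eq_integral => t _.
  rewrite big_ord_recl tnth0 /G /=; congr (((_ + _) ^+ 2)%:E).
  by apply: eq_bigr => i _; rewrite tnthS.
rewrite (@fubini_tonelli _ _ _ _ _ p (iid_law p m) G mG G0).
have -> : ((m.+1%:R * B ^+ 2)%:E = \int[iid_law p m]_t cst (B ^+ 2)%:E t +
    (m%:R * B ^+ 2)%:E)%E.
  rewrite integral_prob_cst -EFinD.
  by congr (_%:E); rewrite -natr1; ring.
apply: (@le_trans _ _ (\int[iid_law p m]_t (cst (B ^+ 2)%:E t +
    ((\sum_(i < m) f (tnth t i)) ^+ 2)%:E))%E).
  apply: ge0_le_integral => //.
  - by move=> t _; apply: integral_ge0 => s _; exact: G0.
  - exact: (@measurable_fun_fubini_tonelli_G _ _ _ _ _ p G mG G0).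
  - apply: emeasurable_funD; first exact: measurable_cst.
    by apply/measurable_EFinP; exact: measurable_funX.
  move=> t _.
  by have := second_moment_shift (\sum_(i < m) f (tnth t i)); rewrite EFinD; exact.
rewrite ge0_integralD//.
- exact: leeD2l.
- by move=> t _; rewrite lee_fin sqr_ge0.
- by move=> t _; rewrite lee_fin sqr_ge0.
- by apply/measurable_EFinP; exact: measurable_funX.
Qed.

Lemma iid_chebyshev m (a : R) : 0 < a ->
  (iid_law p m [set z | (a <= `|\sum_(i < m) f (tnth z i)|)%R] <=
   (m%:R * B ^+ 2 / a ^+ 2)%:E)%E.
Proof.
move=> a0.
have mS := @measurable_tuple_sum m.
have mS2 : measurable_fun [set: m.-tuple S]
    (fun z => ((\sum_(i < m) f (tnth z i)) ^+ 2)%:E).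
  by apply/measurable_EFinP; exact: measurable_funX.
have := @le_integral_abse _ _ _ (iid_law p m) _ measurableT _ (a ^+ 2) mS2.
rewrite exprn_gt0// => /(_ isT).
rewrite setTI; under [X in (_ <= X)%E]eq_integral => z _ do
  rewrite gee0_abs ?lee_fin ?sqr_ge0//.
move=> /le_trans/(_ (iid_second_moment m)).
rewrite (_ : [set z | _] = [set z | a <= `|\sum_(i < m) f (tnth z i)|]); last first.
  apply/seteqP; split => z /=; rewrite lee_fin normrX ler_sqr ?nnegrE//; exact: ltW.
by move=> H; rewrite EFinM lee_pdivlMr ?exprn_gt0// muleC.
Qed.

End second_moment.

(** * Rademacher sums *)

Section rademacher.
Context (R : realType).

Lemma nondecreasing_from0 (f df : R -> R) (x : R) :
  (forall y : R, is_derive y 1 f (df y)) -> (forall y, 0 <= y -> 0 <= df y) ->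
  0 <= x -> f 0 <= f x.
Proof.
move=> fdf df0 x0.
have cf : {within `[0, x], continuous f}.
  apply: continuous_subspaceT => y.
  apply: differentiable_continuous; apply/derivable1_diffP.
  by have := fdf y; case.
have [c + fx] := MVT_segment x0 (fun y _ => fdf y) cf.
rewrite in_itv/= => /andP[c0 _].
by rewrite -subr_ge0 fx mulr_ge0 ?df0// subr0.
Qed.

Section pointwise_derivatives.
Implicit Types (f g : R -> R) (y a b : R).

Let is_derive_exp f y a : is_derive y 1 f a ->
  is_derive y 1 (fun z => expR (f z)) (expR (f y) * a).
Proof. by move=> fa; exact: (is_derive1_comp (is_derive_expR (f y)) fa). Qed.

Let is_derive_mul f g y a b : is_derive y 1 f a -> is_derive y 1 g b ->
  is_derive y 1 (fun z => f z * g z) (f y * b + g y * a).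
Proof. by move=> fa gb; exact: (is_deriveM fa gb). Qed.

Let is_derive_sub f g y a b : is_derive y 1 f a -> is_derive y 1 g b ->
  is_derive y 1 (fun z => f z - g z) (a - b).
Proof. by move=> fa gb; exact: (is_deriveB fa gb). Qed.

Let is_derive_add f g y a b : is_derive y 1 f a -> is_derive y 1 g b ->
  is_derive y 1 (fun z => f z + g z) (a + b).
Proof. by move=> fa gb; exact: (is_deriveD fa gb). Qed.

Let is_derive_opp f y a : is_derive y 1 f a ->
  is_derive y 1 (fun z => - f z) (- a).
Proof. by move=> fa; exact: (is_deriveN fa). Qed.

Let is_derive_idfun y : is_derive y 1 (fun z => z) (1 : R).
Proof. exact: is_derive_id. Qed.

(* With g y = y cosh y - sinh y (up to a factor 2), g' = y sinh y >= 0, and the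
   derivative of - cosh y * exp (- y^2 / 2) is g y * exp (- y^2 / 2). *)
Lemma cosh_le (x : R) : expR x + expR (- x) <= 2 * expR (x ^+ 2 / 2).
Proof.
wlog x0 : x / 0 <= x => [H|].
  have [/H//|/ltW x0] := leP 0 x.
  by have := H (- x); rewrite oppr_ge0 opprK sqrrN addrC; exact.
have dE := is_derive_expR.
have dEN y := is_derive_exp (is_derive_opp (is_derive_idfun y)).
pose g y : R := y * (expR y + expR (- y)) - (expR y - expR (- y)).
have dg y : is_derive y 1 g (y * (expR y - expR (- y))).
  apply: is_derive_eq (is_derive_sub (is_derive_mul (is_derive_idfun y)
    (is_derive_add (dE _ y) (dEN y))) (is_derive_sub (dE _ y) (dEN y))) _.
  ring.
have g0 y : 0 <= y -> 0 <= g y.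
  move=> y0; have -> : 0 = g 0 by rewrite /g oppr0 subrr mul0r subrr.
  apply: (nondecreasing_from0 dg) => // z z0.
  by rewrite mulr_ge0// subr_ge0 ler_expR; lra.
pose f y : R := - ((expR y + expR (- y)) * expR (- (y * y / 2))).
have df y : is_derive y 1 f (g y * expR (- (y * y / 2))).
  apply: is_derive_eq (is_derive_opp (is_derive_mul
    (is_derive_add (dE _ y) (dEN y)) (is_derive_exp (is_derive_opp
    (is_derive_mul (is_derive_mul (is_derive_idfun y) (is_derive_idfun y))
    (is_derive_cst (2^-1 : R) y 1)))))) _.
  by rewrite /g /=; field.
have : f 0 <= f x.
  apply: (nondecreasing_from0 df) => // z z0.
  by rewrite mulr_ge0 ?g0 ?expR_ge0.
rewrite /f lerN2 oppr0 expR0 !mul0r oppr0 expR0 mulr1 (expRN (x * x / 2)).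
by rewrite ler_pdivrMr ?expR_gt0// expr2.
Qed.

End pointwise_derivatives.

Definition signed_sum m (sg : {ffun 'I_m -> bool}) (c : 'I_m -> R) : R :=
  \sum_(i < m) if sg i then - c i else c i.

(** With a sum over sign patterns in place of an expectation, independence of the signs is
    distributivity. *)
Lemma rademacher_mgf m (c : 'I_m -> R) :
  \sum_(sg : {ffun 'I_m -> bool}) expR (signed_sum sg c) =
  \prod_(i < m) (expR (c i) + expR (- c i)).
Proof.
transitivity (\prod_(i < m) \sum_(b : bool) expR (if b then - c i else c i)).
  rewrite bigA_distr_bigA/=; apply: eq_bigr => sg _.
  by rewrite /signed_sum expR_sum.
by apply: eq_bigr => i _; rewrite big_bool addrC.
Qed.

Lemma rademacher_upper_tail m (c : 'I_m -> R) (B T : R) :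
  (0 < m)%N -> 0 < B -> 0 < T -> (forall i, `|c i| <= B) ->
  \sum_(sg : {ffun 'I_m -> bool}) (T <= signed_sum sg c)%R%:R <=
  2 ^+ m * expR (- (T ^+ 2 / (2 * m%:R * B ^+ 2))).
Proof.
(* Chernoff parameter: it minimizes m la^2 B^2 / 2 - la T. *)
move=> m0 B0 T0 cB; pose la := T / (m%:R * B ^+ 2).
have mR : 0 < m%:R :> R by rewrite ltr0n.
have la0 : 0 < la by rewrite divr_gt0// mulr_gt0// exprn_gt0.
apply: (@le_trans _ _ (\sum_(sg : {ffun 'I_m -> bool})
    expR (signed_sum sg (fun i => la * c i)) * expR (- (la * T)))).
  apply: ler_sum => sg _; rewrite -expRD.
  have -> : signed_sum sg (fun i => la * c i) = la * signed_sum sg c.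
    by rewrite mulr_sumr; apply: eq_bigr => i _; case: ifP; rewrite // mulrN.
  case: (leP T (signed_sum sg c)) => Tc; last exact: expR_ge0.
  by rewrite -[leLHS]expR0 ler_expR -mulrBr mulr_ge0 ?subr_ge0// ltW.
rewrite -mulr_suml rademacher_mgf.
apply: (@le_trans _ _ (\prod_(i < m) (2 * expR ((la * B) ^+ 2 / 2)) *
    expR (- (la * T)))).
  rewrite ler_wpM2r ?expR_ge0//; apply: ler_prod => i _.
  rewrite addr_ge0 ?expR_ge0//=; apply: le_trans (cosh_le _) _.
  rewrite ler_wpM2l// ler_expR ler_wpM2r ?invr_ge0//.
  rewrite [leLHS]exprMn [leRHS]exprMn ler_wpM2l ?sqr_ge0//.
  by rewrite -(real_normK (num_real (c i))) ler_sqr ?nnegrE// ltW.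
rewrite prodr_const card_ord [(_ * expR _) ^+ m]exprMn -[leLHS]mulrA ler_wpM2l ?exprn_ge0//.
rewrite -expRM_natl -expRD ler_expR le_eqVlt; apply/orP; left; apply/eqP.
rewrite /la; field.
by rewrite !gt_eqF.
Qed.

Lemma rademacher_tail m (c : 'I_m -> R) (B T : R) :
  (0 < m)%N -> 0 < B -> 0 < T -> (forall i, `|c i| <= B) ->
  \sum_(sg : {ffun 'I_m -> bool}) (T <= `|signed_sum sg c|)%R%:R <=
  2 * (2 ^+ m * expR (- (T ^+ 2 / (2 * m%:R * B ^+ 2)))).
Proof.
move=> m0 B0 T0 cB.
apply: (@le_trans _ _ (\sum_(sg : {ffun 'I_m -> bool})
    ((T <= signed_sum sg c)%R%:R + (T <= signed_sum sg (fun i => - c i))%R%:R))).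
  apply: ler_sum => sg _.
  have -> : signed_sum sg (fun i => - c i) = - signed_sum sg c.
    by rewrite -sumrN; apply: eq_bigr => i _; case: ifP.
  rewrite -natrD ler_nat ler_normr.
  by case: (T <= _) => //; case: (T <= _).
rewrite big_split/= mulr_natl mulr2n.
by apply: lerD; apply: rademacher_upper_tail => // i; rewrite normrN.
Qed.

End rademacher.

(** * Covers and losses *)

Section empirical_measure.
Context d (S : measurableType d) (R : realType) (x0 : S) (s : seq S).
Local Open Scope ereal_scope.

(** Keeping [x0] apart makes the list [x0 :: s] nonempty, so that the total mass is 1. *)
Definition empirical_measure : set S -> \bar R :=
  mscale (((size s).+1%:R^-1)%:nng)%R
    (msum (fun i => \d_(nth x0 (x0 :: s) i)) (size s).+1).

HB.instance Definition _ := Measure.on empirical_measure.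

Let empirical_measure_setT : empirical_measure setT = 1.
Proof.
rewrite /empirical_measure /mscale /= /msum.
rewrite (eq_bigr (fun=> 1%R%:E)) => [|i _]; last exact: diracT.
by rewrite sumEFin sumr_const card_ord -EFinM mulVf.
Qed.

HB.instance Definition _ :=
  @Measure_isProbability.Build _ _ R empirical_measure empirical_measure_setT.

Lemma integral_empirical_measure (f : S -> R) :
  measurable_fun [set: S] f -> (forall x, 0 <= f x)%R ->
  \int[empirical_measure]_x (f x)%:E =
  ((size s).+1%:R^-1 * \sum_(x <- x0 :: s) f x)%:E.
Proof.
move=> mf f0.
have mF : measurable_fun [set: S] (EFin \o f) by exact/measurable_EFinP.
rewrite ge0_integral_mscale//; last by move=> x _; rewrite lee_fin.
rewrite ge0_integral_measure_sum//; last by move=> x _; rewrite lee_fin.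
rewrite EFinM; congr (_ * _).
rewrite (big_nth x0) big_mkord -sumEFin; apply: eq_bigr => i _.
by rewrite integral_dirac// diracT mul1e.
Qed.

End empirical_measure.

Section covers.
Context d (S : measurableType d) (R : realType) (A : Type).
Variables (H : set (S -> A)) (dist : A -> A -> R).
Hypothesis dist_ge0 : forall a b, 0 <= dist a b.
Hypothesis measurable_dist : forall f g, H f -> H g ->
  measurable_fun [set: S] (fun x => dist (f x) (g x)).

(** The capacity bounds the covering number for the empirical measure of [x0 :: s], whose L^1
    distance is a finite average. The strict inequality produces an actual cover, and [h0] makes it
    nonempty, hence indexable by ['I_N]. *)
Lemma capacity_cover (eps c : R) (h0 : S -> A) (x0 : S) (s : seq S) : H h0 ->
  (capacity eps H dist < c%:E)%E ->
  exists N (F : 'I_N -> S -> A),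
    [/\ N%:R < c, forall i, H (F i) &
      forall h, H h -> exists i,
        \sum_(x <- x0 :: s) dist (F i x) (h x) <= (size s).+1%:R * eps].
Proof.
move=> Hh0 capc; pose P : probability S R := empirical_measure R x0 s.
have : (covering_number eps H (dL1 P dist) < c%:E)%E.
  by apply: le_lt_trans capc; apply: ereal_sup_ubound; exists P.
move=> /ereal_inf_lt[_ [N [F [FH FN FP]] <-]]; rewrite lte_fin => Nc.
have FN1 : (F #<= `I_N)%card by case/card_eqPle: FN.
have [F0|/unsquash f] : F = set0 \/ $|{surjfun `I_N >-> F}| by exact/pfcard_geP.
  by have [g] := FP _ Hh0; rewrite F0.
exists N, (fun i => f i); split => //.
  by move=> i; apply/FH/(@funS _ _ _ _ f)/(ltn_ord i).
move=> h Hh; have [g Fg gh] := FP _ Hh.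
have [i iN fi] := (@surj _ _ _ _ f) g Fg; exists (Ordinal iN).
have Hg := FH _ Fg; rewrite /= fi.
move: gh; rewrite /dL1 integral_empirical_measure//; last exact: measurable_dist.
by rewrite lee_fin ler_pdivrMl ?ltr0n.
Qed.

Lemma capacity_ge1 (eps : R) : H !=set0 -> (1 <= capacity eps H dist)%E.
Proof.
move=> [h Hh]; pose P : probability S R := \d_point.
apply: (@le_trans _ _ (covering_number eps H (dL1 P dist))); last first.
  by apply: ereal_sup_ubound; exists P.
apply: le_ereal_inf_tmp => _ [N [F [FH FN FP]] <-].
rewrite lee_fin (ler_nat _ 1%N) lt0n; apply/eqP => N0; subst N.
have F0 : F = set0 by move: FN; rewrite II0 card_eq0 => /eqP.
by have [f] := FP _ Hh; rewrite F0.
Qed.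

End covers.

(** * Lipschitz constant, range and measurability of the loss *)

Section loss_theory.
Context (R : realType) (n : nat).
Implicit Types (y : attack n) (a b : n.-tuple R) (M : R).

Definition log_partition a : R := ln (1 + \sum_(j < n) expR (tnth a j)).

Lemma partition_gt0 a : 0 < 1 + \sum_(j < n) expR (tnth a j).
Proof. by rewrite ltr_pwDl// sumr_ge0// => j _; exact: expR_ge0. Qed.

Lemma lossE y a : loss y a = log_partition a - nth 0 a y.
Proof.
rewrite /loss ln_div ?posrE ?expR_gt0 ?partition_gt0// expRK.
by rewrite opprB.
Qed.

(** Log-sum-exp is monotone and commutes with adding a constant; [0 <= c] is the comparison at the
    reference target, whose exponent is 0 on both sides. *)
Lemma log_partition_le a b (c : R) : 0 <= c ->
  (forall j, tnth a j <= c + tnth b j) ->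
  log_partition a <= c + log_partition b.
Proof.
move=> c0 ab; rewrite -[X in X + _]expRK -lnM ?posrE ?expR_gt0 ?partition_gt0//.
rewrite ler_ln ?posrE ?mulr_gt0 ?expR_gt0 ?partition_gt0// mulrDr mulr1.
rewrite lerD//; first by rewrite -[leLHS]expR0 ler_expR.
by rewrite mulr_sumr; apply: ler_sum => j _; rewrite -expRD ler_expR.
Qed.

Definition l1_dist a b : R := \sum_(j < n) `|tnth a j - tnth b j|.

Lemma l1_distC a b : l1_dist a b = l1_dist b a.
Proof. by apply: eq_bigr => j _; rewrite distrC. Qed.

Lemma coordinate_le_l1_dist a b j : `|tnth a j - tnth b j| <= l1_dist a b.
Proof. by rewrite /l1_dist (bigD1 j)//= lerDl sumr_ge0. Qed.

Lemma two_coordinates_le_l1_dist a b j k : j != k ->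
  `|tnth a j - tnth b j| + `|tnth a k - tnth b k| <= l1_dist a b.
Proof.
move=> jk; rewrite /l1_dist (bigD1 j)//= (bigD1 k) 1?eq_sym//= addrA.
by rewrite lerDl sumr_ge0.
Qed.

(** Apply [log_partition_le] with the shift l1 + (a_y - b_y). At coordinate y the two copies of a_y
    - b_y cancel; at another j the claim involves two distinct coordinates, whose differences
    together are at most l1. This keeps the constant at 1 instead of 2. *)
Lemma loss_lipschitz y a b : `|loss y a - loss y b| <= l1_dist a b.
Proof.
wlog suff : a b / loss y a <= l1_dist a b + loss y b.
  move=> H; rewrite ler_norml; apply/andP; split.
    by have := H b a; rewrite l1_distC; lra.
  by have := H a b; lra.
rewrite !lossE.
have l0 : 0 <= l1_dist a b by rewrite sumr_ge0.
suff : log_partition a <= (l1_dist a b + (nth 0 a y - nth 0 b y)) + log_partition b.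
  by lra.
have nthE (u : n.-tuple R) (yn : (y < n)%N) : nth 0 u y = tnth u (Ordinal yn).
  by rewrite (tnth_nth 0).
apply: log_partition_le => [|j].
  have [yn|ny] := ltnP y n.
    rewrite !(nthE _ yn); have := coordinate_le_l1_dist a b (Ordinal yn).
    by rewrite ler_norml; lra.
  by rewrite !nth_default ?size_tuple// subrr addr0.
have [yn|ny] := ltnP y n; last first.
  rewrite !nth_default ?size_tuple// subrr addr0.
  by have := coordinate_le_l1_dist a b j; rewrite ler_norml; lra.
rewrite !(nthE _ yn); have [->|jy] := eqVneq j (Ordinal yn); first by lra.
have := two_coordinates_le_l1_dist a b jy.
have := ler_norm (tnth a j - tnth b j).
have := ler_norm (tnth b (Ordinal yn) - tnth a (Ordinal yn)).
by rewrite [`|tnth b _ - _|]distrC; lra.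
Qed.

(** The log-partition terms differ by at most M, whatever the number of summands, and so do the two
    selected coordinates. *)
Lemma loss_range M y y' a b : 0 < M ->
  (forall j, - (M / 2) <= tnth a j <= M / 2) ->
  (forall j, - (M / 2) <= tnth b j <= M / 2) ->
  `|loss y a - loss y' b| <= 2 * M.
Proof.
move=> M0.
wlog suff : y y' a b / (forall j, - (M / 2) <= tnth a j <= M / 2) ->
    (forall j, - (M / 2) <= tnth b j <= M / 2) ->
    loss y a <= 2 * M + loss y' b.
  move=> H ha hb; rewrite ler_norml; apply/andP; split.
    by have := H y' y b a hb ha; lra.
  by have := H y y' a b ha hb; lra.
move=> ha hb; rewrite !lossE.
have nthb (u : n.-tuple R) (z : attack n) :
    (forall j, - (M / 2) <= tnth u j <= M / 2) -> - (M / 2) <= nth 0 u z <= M / 2.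
  move=> hu; have [zn|nz] := ltnP z n.
    by have := hu (Ordinal zn); rewrite (tnth_nth 0).
  by rewrite nth_default ?size_tuple//; apply/andP; split; lra.
have : log_partition a <= M + log_partition b.
  apply: log_partition_le => [|j]; first exact: ltW.
  by have := ha j; have := hb j; lra.
by have := nthb a y ha; have := nthb b y' hb; lra.
Qed.

Section measurability.
Context d (T : measurableType d).

Lemma measurable_log_partition (f : T -> n.-tuple R) :
  measurable_fun [set: T] f -> measurable_fun [set: T] (log_partition \o f).
Proof.
move=> mf; apply: (measurableT_comp (@measurable_ln R)) => //.
apply: measurable_funD; first exact: measurable_cst.
apply: measurable_sum => j; apply: measurableT_comp; first exact: measurable_expR.
exact: (measurableT_comp (measurable_tnth j) mf).
Qed.

Lemma measurable_loss (g : T -> attack n) (f : T -> n.-tuple R) :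
  measurable_fun [set: T] g -> measurable_fun [set: T] f ->
  measurable_fun [set: T] (fun t => loss (g t) (f t)).
Proof.
move=> mg mf.
have mk (k : attack n) : measurable_fun [set: T] (fun t => loss k (f t)).
  under eq_fun do rewrite lossE.
  apply: measurable_funB; first exact: measurable_log_partition.
  have [kn|nk] := ltnP k n.
    rewrite (_ : (fun t => _) = (fun t => tnth (f t) (Ordinal kn))).
      exact: (measurableT_comp (measurable_tnth _) mf).
    by apply/funext => t; rewrite (tnth_nth 0).
  rewrite (_ : (fun t => _) = cst 0); first exact: measurable_cst.
  by apply/funext => t; rewrite nth_default ?size_tuple.
rewrite (_ : (fun t => _) = fun t =>
    \sum_(k < n.+1) \1_(g @^-1` [set k]) t * loss k (f t)).
  apply: measurable_sum => k; apply: measurable_funM => //.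
  apply: measurable_indic; rewrite -[X in measurable X]setTI; exact: mg.
apply/funext => t; rewrite (bigD1 (g t))//= big1 ?addr0 => [|k kg].
  by rewrite indicE mem_set// mul1r.
by rewrite indicE memNset ?mul0r// => /= gk; rewrite gk eqxx in kg.
Qed.

Lemma measurable_avg_l1 (f g : T -> n.-tuple R) :
  measurable_fun [set: T] f -> measurable_fun [set: T] g ->
  measurable_fun [set: T] (fun t => avg_l1 (f t) (g t)).
Proof.
move=> mf mg; apply: measurable_funM; first exact: measurable_cst.
apply: measurable_sum => j; apply: measurableT_comp => //.
apply: measurable_funB.
- exact: (measurableT_comp (measurable_tnth j) mf).
- exact: (measurableT_comp (measurable_tnth j) mg).
Qed.

End measurability.
End loss_theory.

(** * Uniform deviation *)

Section permissible_classes.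
Context (R : realType).

Lemma measurable_preimage_rectangles d d0 (S : measurableType d)
    (T : measurableType d0) (E : topologicalType) (psi : T -> S * E)
    (C : set (S * E)) :
  (forall (U : set S) (V : set E), measurable U -> open V ->
    measurable (psi @^-1` (U `*` V))) ->
  <<s [set U `*` V | U in (measurable : set (set S)) & V in open] >> C ->
  measurable (psi @^-1` C).
Proof.
move=> mUV; apply: (@smallest_sub _ _ _ [set C | measurable (psi @^-1` C)]).
  split => /= [|A mA|F mF].
  - by rewrite preimage_set0.
  - by rewrite setTD preimage_setC; exact: measurableC.
  - by rewrite preimage_bigcup; exact: bigcup_measurable.
by move=> _ [U mU [V oV <-]]; exact: mUV.
Qed.

(** Composing the indexing of [H] with the continuous map onto the analytic index set turns
    quantification over [H] into quantification over sequences. The last clause is joint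
    measurability for the rectangles pulled back along [g], the form needed for projecting. *)
Lemma permissible_baire d d' (S : measurableType d) (A : measurableType d')
    (H : set (S -> A)) : permissible R H -> H !=set0 ->
  exists (E : topologicalType) (g : {ptws nat -> nat} -> E)
      (hu : (nat -> nat) -> S -> A),
    [/\ continuous g, H = range hu,
      forall h, H h -> measurable_fun [set: S] h &
      forall d0 (T : measurableType d0) (x : T -> S),
        measurable_fun [set: T] x ->
        measurable_fun [set: g_sigma_algebraType (@baire_rectangles _ T _ g)]
          (fun w => hu w.2 (x w.1))].
Proof.
move=> [E [I [f [_ aI HE mf]]]] [h0 Hh0].
have [I0|[g [cg Ig]]] := aI.
  by move: Hh0; rewrite HE I0 image_set0.
exists E, g, (f \o g); split => //.
- rewrite HE Ig; apply/seteqP; split => [_ [_ [u _ <-] <-]|_ [u _ <-]].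
    by exists u.
  by exists (g u) => //; exists u.
- rewrite HE => _ [th Ith <-] _ B mB; rewrite setTI.
  have [C sC BC] := mf _ mB.
  rewrite (_ : _ @^-1` _ = (fun x => (x, th)) @^-1` C); last first.
    by apply/seteqP; split => x /=; rewrite BC.
  apply: measurable_preimage_rectangles sC => U V mU oV.
  have [Vth|nVth] := pselect (V th).
    by rewrite (_ : _ @^-1` _ = U)//; apply/seteqP; split => x // [].
  by rewrite (_ : _ @^-1` _ = set0)//; apply/seteqP; split => x // [].
- move=> d0 T x mx _ B mB; rewrite setTI.
  have [C sC BC] := mf _ mB.
  rewrite (_ : _ @^-1` _ = (fun w => (x w.1, g w.2)) @^-1` C); last first.
    by apply/seteqP; split => w /=; rewrite BC// Ig; exists w.2.
  apply: measurable_preimage_rectangles sC => U V mU oV.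
  apply: sub_sigma_algebra; exists (x @^-1` U).
    by rewrite -[X in measurable X]setTI; exact: mx.
  by exists V.
Qed.

Lemma measurable_baire_fst d (T : measurableType d) (E : topologicalType)
    (g : {ptws nat -> nat} -> E) :
  measurable_fun [set: g_sigma_algebraType (@baire_rectangles _ T _ g)]
    (fun w => w.1 : T).
Proof.
move=> _ U mU; rewrite setTI; apply: sub_sigma_algebra.
exists U => //; exists setT; first exact: openT.
by apply/seteqP; split => // w [].
Qed.

End permissible_classes.

Section uniform_deviation.
Context (R : realType) (n K : nat) (M : R) (H : set (hypothesis R n K)).
Local Notation Z := (datum R n K).
Hypotheses (M_gt0 : 0 < M) (H_bounded : forall h, H h -> bounded_hypothesis M h)
  (H_permissible : permissible R H) (H_neq0 : H !=set0).

Definition point_loss (h : hypothesis R n K) (z : Z) : R := loss z.2 (h z.1).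

Definition sample_gap m (h : hypothesis R n K) (zz : m.-tuple Z * m.-tuple Z) : R :=
  \sum_(i < m) (point_loss h (tnth zz.1 i) - point_loss h (tnth zz.2 i)).

Definition large_gap m (t : R) : set (m.-tuple Z * m.-tuple Z) :=
  [set zz | exists2 h, H h & t <= `|sample_gap h zz|].

Lemma hypothesis_measurable h : H h -> measurable_fun [set: strategy R n K] h.
Proof.
by have [E [g [hu [_ _ + _]]]] := permissible_baire H_permissible H_neq0; exact.
Qed.

Lemma souslin_large_gap m t : souslin (@large_gap m t).
Proof.
have [E [g [hu [cg HE _ mhu]]]] := permissible_baire H_permissible H_neq0.
pose Om : measurableType _ := (m.-tuple Z * m.-tuple Z)%type.
pose W := g_sigma_algebraType (@baire_rectangles _ Om _ g).
pose D := [set w : W | t <= `|sample_gap (hu w.2) w.1|].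
suff mD : measurable D.
  rewrite (_ : large_gap t = [set zz | exists u, D (zz, u)]).
    exact: (generated_souslin_projection cg mD).
  apply/seteqP; split => zz [].
    by move=> h; rewrite HE => -[u _ <-] zt; exists u.
  by move=> u zt; exists (hu u) => //; rewrite HE.
have mfst := @measurable_baire_fst _ Om _ g.
have mpl (pr : Om -> Z) : measurable_fun [set: Om] pr ->
    measurable_fun [set: W] (fun w => point_loss (hu w.2) (pr w.1)).
  move=> mpr; apply: measurable_loss.
    exact: (measurableT_comp (measurableT_comp measurable_snd mpr) mfst).
  apply: (mhu _ Om (fun o => (pr o).1)).
  exact: (measurableT_comp measurable_fst mpr).
have mgap : measurable_fun [set: W] (fun w => sample_gap (hu w.2) w.1).
  apply: measurable_sum => i; apply: measurable_funB.
    apply: (mpl (fun o => tnth o.1 i)).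
    exact: (measurableT_comp (measurable_tnth i) measurable_fst).
  apply: (mpl (fun o => tnth o.2 i)).
  exact: (measurableT_comp (measurable_tnth i) measurable_snd).
rewrite -[D]setTI; have := emeasurable_fun_c_infty (@measurableT _ W)
  (_ : measurable_fun [set: W] (fun w => `|sample_gap (hu w.2) w.1|%:E)) t%:E.
by apply; apply/measurable_EFinP; exact: (measurableT_comp _ mgap).
Qed.

(** Exchanging the i-th observations flips the sign of the i-th term: this is where the Rademacher
    signs come from. *)
Lemma sample_gap_exchange m h (sg : {ffun 'I_m -> bool}) zz :
  sample_gap h (exchange sg zz) = signed_sum sg
    (fun i => point_loss h (tnth zz.1 i) - point_loss h (tnth zz.2 i)).
Proof.
apply: eq_bigr => i _; rewrite !tnth_mktuple.
by case: (sg i); rewrite ?opprB.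
Qed.

Lemma point_loss_range h h' z z' : H h -> H h' ->
  `|point_loss h z - point_loss h' z'| <= 2 * M.
Proof.
by move=> Hh Hh'; apply: loss_range => // j; exact: H_bounded.
Qed.

Lemma measurable_point_loss h : H h -> measurable_fun [set: Z] (point_loss h).
Proof.
move=> Hh; apply: (@measurable_loss _ _ _ Z snd (h \o fst)) => //.
exact: (measurableT_comp (hypothesis_measurable Hh) measurable_fst).
Qed.

Lemma signed_sum_dist m (sg : {ffun 'I_m -> bool}) (a b : 'I_m -> R) :
  `|signed_sum sg a| <= `|signed_sum sg b| + \sum_(i < m) `|a i - b i|.
Proof.
rewrite -lerBlDl; apply: le_trans (lerB_dist _ _) _.
rewrite -sumrB; apply: le_trans (ler_norm_sum _ _ _) _.
apply: ler_sum => i _; case: ifP => // _.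
by rewrite -opprD normrN.
Qed.

(* Union bound over an L^1-cover of H for the empirical measure of the 2m sample
   points: the cover changes sample_gap by at most m eps / 16, which leaves a
   deviation of 7 m eps / 16. *)
Lemma large_gap_average m (eps c : R) zz : (0 < m)%N -> 0 < eps ->
  (capacity (eps / (32 * n.+1%:R)) H (@avg_l1 R n) < c%:E)%E ->
  \sum_(sg : {ffun 'I_m -> bool})
    \1_(large_gap (m%:R * (eps / 2))) (exchange sg zz) <=
  2 * c * expR (- (49 / 2048 * (m%:R * eps ^+ 2 / M ^+ 2))) * 2 ^+ m.
Proof.
move=> m0 e0 capc.
have mR : 0 < m%:R :> R by rewrite ltr0n.
have [h0 Hh0] := H_neq0.
pose s := [seq z.1 | z : Z <- zz.1 ++ zz.2].
have ss : size s = (m + m)%N by rewrite size_map size_cat !size_tuple.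
have [x0 [s' sE]] : exists x0 s', s = x0 :: s'.
  by case: s ss => [/= |x0 s' _]; [rewrite -(prednK m0)|exists x0, s'].
have mavg f g : H f -> H g ->
    measurable_fun [set: strategy R n K] (fun x => avg_l1 (f x) (g x)).
  by move=> Hf Hg; apply: measurable_avg_l1; exact: hypothesis_measurable.
have avg0 (a b : n.-tuple R) : 0 <= avg_l1 a b.
  by rewrite mulr_ge0 ?invr_ge0// sumr_ge0.
have [N [F [Nc FH FP]]] := capacity_cover avg0 mavg x0 s' Hh0 capc.
rewrite -sE in FP.
have ss' : (size s').+1%:R = 2 * m%:R :> R.
  by rewrite (_ : (size s').+1 = size s) ?sE// -sE ss natrD; ring.
pose gap h i := point_loss h (tnth zz.1 i) - point_loss h (tnth zz.2 i).
have gapB h i : H h -> `|gap h i| <= 2 * M by move=> Hh; exact: point_loss_range.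
pose T := m%:R * (7 / 16 * eps).
have cover_gap h : H h -> exists j, \sum_(i < m) `|gap h i - gap (F j) i| <=
    m%:R * (eps / 16).
  move=> Hh; have [j Fj] := FP _ Hh; exists j.
  apply: (@le_trans _ _ (\sum_(x <- s) l1_dist (F j x) (h x))).
    rewrite /s big_map big_cat/= !big_tuple -big_split/=.
    apply: ler_sum => i _; rewrite /gap.
    have -> : forall a b c d : R, a - b - (c - d) = (a - c) + (d - b).
      by move=> *; ring.
    apply: le_trans (ler_normD _ _) _; apply: lerD; last exact: loss_lipschitz.
    by rewrite distrC; exact: loss_lipschitz.
  have -> : \sum_(x <- s) l1_dist (F j x) (h x) =
      n%:R * \sum_(x <- s) avg_l1 (F j x) (h x).
    rewrite mulr_sumr; apply: eq_bigr => x _; rewrite /avg_l1 mulrA.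
    have [n0|n0] := eqVneq n 0%N; last by rewrite divff ?mul1r// pnatr_eq0.
    by rewrite /l1_dist; move: (F j x) (h x); rewrite n0 => a b; rewrite !big_ord0 mulr0.
  (* There are 2m points in [s]. Passing from [avg_l1] to the l1 distance costs a factor [n],
     absorbed by the [n.+1] in the radius. *)
  apply: (@le_trans _ _ (n%:R * (2 * m%:R * (eps / (32 * n.+1%:R))))).
    by rewrite ler_wpM2l// -ss'.
  have -> : n%:R * (2 * m%:R * (eps / (32 * n.+1%:R))) =
      m%:R * (eps / 16) * (n%:R / n.+1%:R) :> R by field; rewrite ?natr1 ?nat1r pnatr_eq0.
  rewrite ler_piMr// ?mulr_ge0 ?divr_ge0//; first exact: ltW.
  by rewrite ler_pdivrMr ?ltr0n// mul1r ler_nat.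
apply: (@le_trans _ _ (\sum_(sg : {ffun 'I_m -> bool}) \sum_(j < N)
    (T <= `|signed_sum sg (gap (F j))|)%R%:R)).
  apply: ler_sum => sg _; rewrite indicE.
  case: (boolP (_ \in _)) => [|_]; last by rewrite sumr_ge0.
  rewrite inE => -[h Hh]; rewrite sample_gap_exchange -/(gap h) => hgap.
  have [j hj] := cover_gap _ Hh.
  rewrite (bigD1 j)//= (_ : T <= _) ?lerDl ?sumr_ge0//.
  have := le_trans hgap (signed_sum_dist sg (gap h) (gap (F j))).
  by rewrite /T; lra.
rewrite exchange_big/=.
apply: (@le_trans _ _ (\sum_(j < N)
    2 * (2 ^+ m * expR (- (T ^+ 2 / (2 * m%:R * (2 * M) ^+ 2)))))).
  apply: ler_sum => j _; apply: rademacher_tail => //.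
  - by rewrite mulr_gt0.
  - by rewrite !mulr_gt0.
  - by move=> i; exact: gapB.
rewrite sumr_const card_ord -[leLHS]mulr_natl.
have -> : T ^+ 2 / (2 * m%:R * (2 * M) ^+ 2) =
    49 / 2048 * (m%:R * eps ^+ 2 / M ^+ 2).
  by rewrite /T; field; rewrite !gt_eqF.
set E := expR _.
have -> : 2 * c * E * 2 ^+ m = c * (2 * (2 ^+ m * E)) by ring.
rewrite ler_wpM2r ?(ltW Nc)// !mulr_ge0 ?exprn_ge0 ?expR_ge0//.
Qed.

Section fixed_law.
Variables (p : probability Z R) (m : nat) (eps c eta : R).
Hypotheses (m_gt0 : (0 < m)%N) (eps_gt0 : 0 < eps) (eta_gt0 : 0 < eta)
  (capc : (capacity (eps / (32 * n.+1%:R)) H (@avg_l1 R n) < c%:E)%E)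
  (m_large : 32 * M ^+ 2 <= m%:R * eps ^+ 2).

Let bound : R := 2 * c * expR (- (49 / 2048 * (m%:R * eps ^+ 2 / M ^+ 2))).

(** The average over exchanges is bounded for the large-gap event itself, hence for any measurable
    [B] inside it; [eta] is the outer probability lost by passing to [B]. *)
Lemma large_gap_outer :
  (outer_prob (iid_law p m \x iid_law p m)%E
     (@large_gap m (m%:R * (eps / 2))%R) <= (bound + eta)%:E)%E.
Proof.
have [B [mB BA AB]] := souslin_capacitable (iid_law p m \x iid_law p m)%E
  (@souslin_large_gap m (m%:R * (eps / 2))) eta_gt0.
apply: le_trans AB _; rewrite EFinD leeD2r//.
apply: iid_law2_average => // zz.
apply: le_trans (large_gap_average zz m_gt0 eps_gt0 capc).
apply: ler_sum => sg _; rewrite !indicE ler_nat.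
case: (boolP (_ \in B)) => //; rewrite inE => /BA gzz.
by rewrite mem_set.
Qed.

Lemma point_loss_integrable h : H h -> p.-integrable setT (EFin \o point_loss h).
Proof.
move=> Hh.
apply: (@bounded_integrable _ _ _ _ _ (2 * M + `|point_loss h point|)).
  exact: measurable_point_loss.
move=> z; have := point_loss_range z point Hh Hh.
have := lerB_dist (point_loss h z) (point_loss h point); lra.
Qed.

Lemma true_risk_dist h z : H h -> `|point_loss h z - true_risk p h| <= 2 * M.
Proof.
move=> Hh; have Ih := point_loss_integrable Hh.
have Ic (k : R) := finite_measure_integrable_cst p k (@measurableT _ Z).
have Rc (k : R) : \int[p]_x cst k x = k.
  by rewrite /Rintegral (integral_prob_cst p k%:E).
have risk_le : true_risk p h <= point_loss h z + 2 * M.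
  rewrite -(Rc (_ + _)); apply: le_Rintegral => // x _.
  by have := point_loss_range x z Hh Hh; rewrite ler_norml /point_loss /=; lra.
have risk_ge : point_loss h z - 2 * M <= true_risk p h.
  rewrite -(Rc (_ - _)); apply: le_Rintegral => // x _.
  by have := point_loss_range x z Hh Hh; rewrite ler_norml /point_loss /=; lra.
by rewrite ler_norml; lra.
Qed.

(* Symmetrization: by Chebyshev, at least half of the ghost samples have an
   empirical risk close to the true one. *)
Lemma uniform_deviation :
  ((1 - 2 * (bound + eta))%:E <= Pr (iid_law p m)
     [set z | forall h, H h ->
        (`|empirical_risk z h - true_risk p h| < eps)%R])%E.
Proof.
pose Q := iid_law p m.
have mR : 0 < m%:R :> R by rewrite ltr0n.
have [C [mC AC PC]] := outer_prob_hull (Q \x Q)%E (@large_gap m (m%:R * (eps / 2))).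
have [D [mD DC PD]] := half_sections Q Q mC.
have QD : (Q D <= (2 * (bound + eta))%:E)%E.
  apply: le_trans PD _; rewrite PC EFinM lee_pmul2l//.
  exact: large_gap_outer.
apply: (@le_trans _ _ (Q (~` D))).
  rewrite probability_setC// EFinB leeB//.
apply: ereal_sup_ubound; exists (~` D) => //; split; first exact: measurableC.
(* Once the bad [z] is given, [h] is fixed, so Chebyshev for this single hypothesis suffices. Ghost
   samples off by less than eps/2 leave a gap of at least eps/2; [G] collects the others. *)
move=> z nDz h Hh; rewrite ltNge; apply/negP => zh; apply: nDz; apply: DC.
pose f x := point_loss h x - true_risk p h.
have mf : measurable_fun [set: Z] f.
  by apply: measurable_funB; [exact: measurable_point_loss|exact: measurable_cst].
have fB x : `|f x| <= 2 * M by exact: true_risk_dist.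
have sumf (t : m.-tuple Z) : \sum_(i < m) f (tnth t i) =
    m%:R * (empirical_risk t h - true_risk p h).
  rewrite sumrB sumr_const card_ord /empirical_risk mulrBr mulrA divff ?mul1r.
    by rewrite mulr_natl.
  by rewrite gt_eqF.
have f0 : (\int[p]_x (f x)%:E = 0)%E.
  have Ih := point_loss_integrable Hh.
  have Ic := finite_measure_integrable_cst p (true_risk p h) (@measurableT _ Z).
  rewrite (integralB_EFin measurableT Ih Ic).
  have -> : (\int[p]_x (EFin \o point_loss h) x = (true_risk p h)%:E)%E.
    by rewrite /true_risk /Rintegral fineK//; exact: integrable_fin_num.
  by rewrite (integral_prob_cst p (true_risk p h)%:E) subee.
have a0 : 0 < m%:R * (eps / 2) by rewrite mulr_gt0// divr_gt0.
have := iid_chebyshev mf fB f0 m a0.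
set G := [set t | _] => QG.
have mG : measurable G.
  have mS := @measurable_tuple_sum _ _ _ f mf m.
  have := emeasurable_fun_c_infty (@measurableT _ (m.-tuple Z))
    (_ : measurable_fun setT (fun t => `|\sum_(i < m) f (tnth t i)|%:E))
    (m%:R * (eps / 2))%:E.
  rewrite setTI; apply.
  by apply/measurable_EFinP; exact: (measurableT_comp _ mS).
(* Chebyshev with the bound 2M gives 16 M^2 / (m eps^2), and [m_large] says exactly that this is at
   most 1/2. *)
have {}QG : (Q G <= 2^-1%:E)%E.
  apply: le_trans QG _; rewrite lee_fin.
  rewrite ler_pdivrMr ?exprn_gt0//.
  have : m%:R * (32 * M ^+ 2) <= m%:R * (m%:R * eps ^+ 2) by rewrite ler_wpM2l.
  have -> : (m%:R * (eps / 2)) ^+ 2 = m%:R * (m%:R * eps ^+ 2) / 4 by field.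
  lra.
apply: (@le_trans _ _ (Q (~` G))).
  rewrite probability_setC//.
  rewrite (_ : 2^-1%:E = 1 - 2^-1%:E)%E; last by rewrite -EFinB; congr EFin; field.
  by rewrite leeB.
apply: le_measure; rewrite ?inE//.
- exact: measurableC.
- exact: measurable_xsection.
move=> z' nG; rewrite /xsection/= inE; apply: AC; exists h => //.
have : ~ (m%:R * (eps / 2) <= `|\sum_(i < m) f (tnth z' i)|) by exact: nG.
move=> /negP; rewrite -ltNge => z'h.
have -> : sample_gap h (z, z') =
    \sum_(i < m) f (tnth z i) - \sum_(i < m) f (tnth z' i).
  by rewrite -sumrB; apply: eq_bigr => i _; rewrite /f/=; ring.
apply: le_trans (lerB_dist _ _).
have : m%:R * eps <= `|\sum_(i < m) f (tnth z i)|.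
  by rewrite sumf normrM gtr0_norm// ler_pM2l.
lra.
Qed.

End fixed_law.

End uniform_deviation.

Theorem theorem1 (R : realType) (n K : nat) (n_gt0 : (0 < n)%N)
    (K_lt : (K < n.+1)%N) (M : R) (M_gt1 : 1 < M)
    (H : set (hypothesis R n K))
    (H_bounded : forall h, H h -> bounded_hypothesis M h)
    (H_permissible : permissible R H)
    (H_erm : exists alg, erm_algorithm H alg)
    (alpha delta : R) (alpha_gt0 : 0 < alpha) (delta_gt0 : 0 < delta)
    (delta_lt1 : delta < 1) (m : nat) :
  ((576 * M ^+ 2 / alpha ^+ 2)%:E *
     ((ln (1 / delta))%:E +
      lne (8%:E * capacity (alpha / (96 * n.+1%:R)) H (@avg_l1 R n)))
   <= m%:R%:E)%E ->
  pac_learnable H alpha delta m.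
Proof.
move=> m_large; have [alg ermP] := H_erm.
have H_neq0 : H !=set0 by exists (alg 0%N [tuple]); case: (ermP 0%N [tuple]).
have M_gt0 : 0 < M by exact: lt_trans M_gt1.
exists alg => // p; split; last first.
  (* An ERM algorithm attains the infimum, so the second event is sure. *)
  rewrite (_ : [set z | _] = setT); last first.
    apply/seteqP; split => // z _ /=.
    have [Ha amin] := ermP m z.
    have -> : min_empirical_risk H z = empirical_risk z (alg m z).
      apply/eqP; rewrite eq_le; apply/andP; split.
        apply: ge_inf; last by exists (alg m z).
        by exists (empirical_risk z (alg m z)) => _ [h Hh <-]; exact: amin.
      apply: lb_le_inf; first by exists (empirical_risk z (alg m z)), (alg m z).
      by move=> _ [h Hh <-]; exact: amin.
    by rewrite subrr normr0 divr_gt0.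
  apply: (@lt_le_trans _ _ 1%E); first by rewrite lte_fin; lra.
  rewrite -(@probability_setT _ _ _ (iid_law p m)).
  by apply: ereal_sup_ubound; exists setT.
have cap1 := capacity_ge1 (@avg_l1 R n) (alpha / (96 * n.+1%:R)) H_neq0.
set ca := capacity _ _ _ in m_large cap1 *.
have coef0 : 0 < 576 * M ^+ 2 / alpha ^+ 2.
  by apply: divr_gt0; [apply: mulr_gt0; [rewrite ltr0n|exact: exprn_gt0]|exact: exprn_gt0].
(* An infinite capacity would make the required sample size infinite, contradicting [m_large]. *)
have [C caE] : exists C, ca = C%:E.
  move: cap1 m_large; case: ca => [C|_|//]; first by exists C.
  by rewrite gt0_muley ?lte_fin//= addey// gt0_muley ?lte_fin.
rewrite caE in cap1 m_large; rewrite lee_fin in cap1.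
rewrite -EFinM lne_EFin ?mulr_gt0// in m_large; last by lra.
rewrite -EFinD -EFinM lee_fin in m_large.
pose q := alpha ^+ 2 * m%:R / (576 * M ^+ 2).
have C0 : 0 < C by lra.
have a2 : 0 < alpha ^+ 2 by exact: exprn_gt0.
have M2 : 0 < M ^+ 2 by exact: exprn_gt0.
have q_large : ln (1 / delta) + ln (8 * C) <= q.
  rewrite -(ler_pM2l coef0); apply: le_trans m_large _.
  by rewrite /q le_eqVlt; apply/orP; left; apply/eqP; field; rewrite !gt_eqF.
have expq : expR (- q) <= delta / (8 * C).
  have <- : expR (- (ln (1 / delta) + ln (8 * C))) = delta / (8 * C).
    by rewrite opprD expRD !expRN !lnK ?posrE ?divr_gt0 ?mulr_gt0// div1r invrK.
  by rewrite ler_expR lerN2.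
pose x := expR (- (q / 2)).
have x0 : 0 < x by exact: expR_gt0.
have xx : x * x = expR (- q) by rewrite /x -expRD; congr expR; field.
have qE : m%:R * (alpha / 3) ^+ 2 / M ^+ 2 = 64 * q.
  by rewrite /q; field; rewrite gt_eqF.
have expq8 : expR (- q) < 1 / 8.
  apply: le_lt_trans expq _; rewrite ltr_pdivrMr ?mulr_gt0//; lra.
(* In terms of [q], the Chebyshev condition 32 M^2 <= m eps^2 reads 32 <= 64 q. *)
have q_ge : 1 / 2 <= q.
  by have := expR_ge1Dx (- q); lra.
have m_gt0 : (0 < m)%N.
  rewrite lt0n; apply/eqP => m0; move: q_ge; rewrite /q m0 mulr0 mul0r.
  by lra.
have capc : (capacity (alpha / 3 / (32 * n.+1%:R)) H (@avg_l1 R n) < (2 * C)%:E)%E.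
  rewrite (_ : alpha / 3 / (32 * n.+1%:R) = alpha / (96 * n.+1%:R)).
    by rewrite -/ca caE lte_fin; lra.
  by field; rewrite ?natr1 ?nat1r pnatr_eq0.
have a3 : 0 < alpha / 3 by rewrite divr_gt0.
have eta0 : 0 < delta / 32 by rewrite divr_gt0.
have m_ge : 32 * M ^+ 2 <= m%:R * (alpha / 3) ^+ 2.
  by rewrite -ler_pdivlMr ?exprn_gt0// qE; lra.
have := @uniform_deviation R n K M H M_gt0 H_bounded H_permissible H_neq0 p m
  (alpha / 3) (2 * C) (delta / 32) m_gt0 a3 eta0 capc m_ge.
apply: lt_le_trans; rewrite lte_fin qE.
have -> : 49 / 2048 * (64 * q) = q + q / 2 + q / 32 by field.
have yle : expR (- (q + q / 2 + q / 32)) <= (x * x) * x.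
  rewrite /x -!expRD ler_expR; lra.
(* The budget delta/2 splits into delta/16 for 2 [eta] and 7 delta/16 for 8 C x^3 <= delta x; the
   latter fits since x^2 < 1/8 < (7/16)^2, by C >= 1 and delta < 1. *)
have x2 : x < 1 / 2 - 1 / 16.
  by rewrite ltNge; apply/negP => x_ge; move: expq8; rewrite -xx; nra.
have : C * (x * x * x) <= delta / 8 * x.
  rewrite !mulrA ler_pM2r// -mulrA xx mulrC -ler_pdivlMr//.
  by rewrite -mulrA -invfM.
have : C * expR (- (q + q / 2 + q / 32)) <= C * (x * x * x) by rewrite ler_pM2l.
have : delta * x < delta * (1 / 2 - 1 / 16) by rewrite ltr_pM2l.
lra.
Qed.
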